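(* Let $k\in\mathbb{R}$, $\lambda\in\mathbb{C}$, and let $s\in\mathbb{C}$ satisfy $s(1-s)=\frac14+\lambda^2$, such that none of $s-|k|$, $s+|k|$, $2s$ is a non-positive integer. Define, for $w\in\mathbb{D}\setminus\{0\}$, with $y=\cosh^2(d(0,w)/2)=1/(1-|w|^2)$, $$G_k(s,w)=\frac{\Gamma(s-|k|)\Gamma(s+|k|)}{4\pi\Gamma(2s)}\,y^{-s}F\big(s-|k|,\,s+|k|,\,2s,\,y^{-1}\big).$$ Then $(-\mathcal{D}_k-\lambda^2)G_k=\delta$ in the sense of distributions on $\mathbb{D}$, where $\delta$ is the Dirac measure at $0$; that is, for every $\varphi\in C_c^\infty(\mathbb{D})$, $$\int_{\mathbb{D}}G_k(s,w)\,\big(-\mathcal{D}_{-k}-\lambda^2\big)\varphi(w)\,d\mu(w)=\varphi(0).$$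
   Context: $\mathbb{D}=\{w\in\mathbb{C}:|w|<1\}$ with hyperbolic metric $ds=2|dw|/(1-|w|^2)$, area measure $d\mu(w)=\frac{4\,du\,dv}{(1-|w|^2)^2}$ ($w=u+iv$), and hyperbolic distance $d$ with $\cosh^2(d(w,w')/2)=\frac{|1-w\overline{w'}|^2}{(1-|w|^2)(1-|w'|^2)}$. For $k\in\mathbb{R}$, $\mathcal{D}_k=(1-|w|^2)^2\frac{\partial^2}{\partial w\partial\bar w}+k(1-|w|^2)w\frac{\partial}{\partial w}-k(1-|w|^2)\bar w\frac{\partial}{\partial\bar w}-k^2|w|^2+k^2+\frac14$; its formal transpose with respect to $d\mu$ is $\mathcal{D}_{-k}$, which defines $\mathcal{D}_k$ on distributions. $F(a,b,c,z)=\sum_{n\ge0}\frac{(a)_n(b)_n}{(c)_n n!}z^n$ is the Gauss hypergeometric function ($(a)_n=\Gamma(a+n)/\Gamma(a)$); $y^{-s}$ is the principal power. *)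

(* Defs.v *)
From HB Require Import structures.
From mathcomp Require Import all_boot all_order all_algebra.
From mathcomp Require Import all_classical all_reals all_analysis.
From mathcomp.real_closed Require Import complex.
Set Implicit Arguments. Unset Strict Implicit. Unset Printing Implicit Defensive.
Import Order.TTheory GRing.Theory Num.Theory.
Import numFieldNormedType.Exports.
Local Open Scope ring_scope.
Local Open Scope complex_scope.

Section Defs.
Variable R : realType.
Local Notation C := R[i].

Definition climn (u : nat -> C) : C :=
  (limn (fun n => complex.Re (u n))) +i* (limn (fun n => complex.Im (u n))).

Definition cexp (z : C) : C :=
  (expR (complex.Re z))%:C * (cos (complex.Im z) +i* sin (complex.Im z)).

Definition cpowR (y : R) (z : C) : C := cexp (z * (ln y)%:C).

Definition poch (a : C) (n : nat) : C := \prod_(j < n) (a + j%:R).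

Definition hyp2F1 (a b c z : C) : C :=
  climn (fun N => \sum_(n < N)
           poch a n * poch b n / (poch c n * (n`!)%:R) * z ^+ n).

(* Euler's Gamma function on C \ {0,-1,-2,...}, via Gauss's limit formula
   Gamma z = lim_n n! n^z / (z (z+1) ... (z+n)) *)
Definition cGamma (z : C) : C :=
  climn (fun n => (n`!)%:R * cpowR n%:R z / poch z n.+1).

(* the point w = u + i v of the disc, |w|^2 *)
Definition sqn (p : R * R) : R := p.1 ^+ 2 + p.2 ^+ 2.
Definition disc : set (R * R) := [set p | sqn p < 1].

(* G_k(s,w), y = cosh^2(d(0,w)/2) = 1/(1-|w|^2) *)
Definition Gk (k : R) (s : C) (p : R * R) : C :=
  let y := (1 - sqn p)^-1 in
  cGamma (s - `|k|%:C) * cGamma (s + `|k|%:C)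
    / ((4 * pi)%:C * cGamma (2 * s))
  * cpowR y (- s) * hyp2F1 (s - `|k|%:C) (s + `|k|%:C) (2 * s) (y^-1)%:C.

Definition pd (b : bool) (f : R -> R -> R) : R -> R -> R :=
  if b then fun u v => derive1 (fun t => f t v) u
  else fun u v => derive1 (fun t => f u t) v.

Definition pdw (l : seq bool) (f : R -> R -> R) : R -> R -> R :=
  foldr pd f l.

Definition smooth2 (f : R -> R -> R) : Prop :=
  forall l : seq bool,
    continuous (fun p : R * R => pdw l f p.1 p.2) /\
    (forall u v, derivable (fun t => pdw l f t v) u 1 /\
                 derivable (fun t => pdw l f u t) v 1).

Definition test_fun (phi : R -> R -> C) : Prop :=
  smooth2 (fun u v => complex.Re (phi u v)) /\
  smooth2 (fun u v => complex.Im (phi u v)) /\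
  exists r : R, 0 <= r < 1 /\
    forall u v, r ^+ 2 < u ^+ 2 + v ^+ 2 -> phi u v = 0.

Definition cpd (l : seq bool) (phi : R -> R -> C) : R -> R -> C :=
  fun u v => pdw l (fun a b => complex.Re (phi a b)) u v
             +i* pdw l (fun a b => complex.Im (phi a b)) u v.

Definition dw (phi : R -> R -> C) (u v : R) : C :=
  (cpd [:: true] phi u v - 'i * cpd [:: false] phi u v) / 2.
Definition dwbar (phi : R -> R -> C) (u v : R) : C :=
  (cpd [:: true] phi u v + 'i * cpd [:: false] phi u v) / 2.
(* d^2/(dw dwbar) = Laplacian / 4 *)
Definition dwdwbar (phi : R -> R -> C) (u v : R) : C :=
  (cpd [:: true; true] phi u v + cpd [:: false; false] phi u v) / 4.

Definition Dop (k : R) (phi : R -> R -> C) (u v : R) : C :=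
  let w := u +i* v in
  let wb := u -i* v in
  let r2 := u ^+ 2 + v ^+ 2 in
  ((1 - r2) ^+ 2)%:C * dwdwbar phi u v
  + (k * (1 - r2))%:C * w * dw phi u v
  - (k * (1 - r2))%:C * wb * dwbar phi u v
  + (- k ^+ 2 * r2 + k ^+ 2 + 1 / 4)%:C * phi u v.

(* the hyperbolic area density  4/(1-|w|^2)^2  w.r.t. du dv *)
Definition hdens (p : R * R) : R := 4 / (1 - sqn p) ^+ 2.


End Defs.

Notation leb2 R := ((@lebesgue_measure R) \x (@lebesgue_measure R))%E.

(* Main.v *)
(* In the variable t = |w|^2 the function G is radial, t -> C (1-t)^s F(s-|k|, s+|k|, 2s, 1-t), and
   the hypergeometric equation says exactly that it solves the radial equation for 0 < t < 1.
   Multiplying by the density 4/(1-t)^2 turns the integrand into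
     - h Lap phi + (Lap h) phi + q d(phi)/d(theta)
   with h, q radial, which is the divergence of an explicit vector field away from the origin.
   Cutting out the strip |u| < e, integrating by parts and letting e -> 0 leaves the boundary term
     2 \int t h'(t) e/(e^2+v^2) (phi(e,v) + phi(-e,v)) dv,  t = e^2+v^2,
   a Poisson integral, which tends to 4 pi phi(0) lim_(t -> 0) t h'(t) up to sign; strips are more
   convenient than discs because only one-dimensional integrals and Fubini are needed.
   The limit of t h'(t) is that of -C (1-x) F'(x) at x = 1 - t -> 1, and since a + b = c the Taylor
   coefficients of F' converge, by Gauss's product for Gamma, to Gamma(c)/(Gamma(a)Gamma(b)); Abel's
   theorem then gives the value -1/(4 pi).  The same boundedness of the coefficients gives
   F = O(1 - ln t) and t F' = O(1), hence integrability. *)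

Require Import Defs.
From HB Require Import structures.
From mathcomp Require Import all_boot all_order all_algebra.
From mathcomp Require Import all_classical all_reals all_analysis.
From mathcomp.real_closed Require Import complex.
From mathcomp Require Import measurable_realfun ring lra.
Import Order.TTheory GRing.Theory Num.Theory.
Import numFieldNormedType.Exports.
Local Open Scope ring_scope.
Local Open Scope classical_set_scope.
Set Implicit Arguments.
Unset Strict Implicit.
Unset Printing Implicit Defensive.

(** * Borel sets and functions on the plane *)

Section plane_measurability.
Context {R : realType}.

(** Solution and test function are complex, while integration by parts is done over the reals:
    Green's identity is proved for arbitrary real radial [h] and [q] of logarithmic growth, then
    used four times, with the real or imaginary part of the coefficients against that of [phi]. The
    differential equation for [h] is therefore absent from it and serves only to rewrite the
    Laplacian of [h]. The first-order term needs no relation between [q] and [h]: for radial [q] the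
    rotation field [q (-v, u)] is divergence free, so q d(phi)/d(theta) is the divergence of
    [q phi (-v, u)], whose flux through the strip vanishes in the limit. The behaviour of F at 1 is
    read off its Taylor coefficients alone. Because a + b = c, the powers of n in Gauss's products
    cancel and each coefficient of F' is exactly a quotient of three Gauss terms; convergence of
    these terms to a nonzero limit is all that is used about Gamma. The normalization of G_k cancels
    Gamma(c)/(Gamma(a)Gamma(b)), so the limit of t h' is real although every factor is complex; the
    imaginary part of the solution thus carries no mass at the origin. *)

Lemma open_measurable_plane (A : set (R * R)) : open A -> measurable A.
Proof.
move=> oA.
pose box (q : rat * rat * (rat * rat)) : set (R * R) :=
  `]ratr q.1.1, ratr q.1.2[ `*` `]ratr q.2.1, ratr q.2.2[.
(* Boxes not contained in [A] are replaced by the empty set, so that the union runs over the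
   countable type of all rational boxes. *)
pose F q := if `[< box q `<=` A >] then box q else set0.
have -> : A = \bigcup_q F q.
  apply/seteqP; split => [[x y] Axy|[x y] [q _]]; last first.
    by rewrite /F; case: ifPn => // /asboolP; apply.
  have [[U V] /= [/nbhs_ballP[e e0 xU] /nbhs_ballP[d d0 yV]] UVA] :
      nbhs (x, y) A by move/open_nbhs_nbhs : (conj oA Axy).
  rewrite /= in e0 d0.
  have [q1 q1E] := @rat_in_itvoo R (x - e) x ltac:(by rewrite ltrBlDr ltrDl).
  have [q2 q2E] := @rat_in_itvoo R x (x + e) ltac:(by rewrite ltrDl).
  have [q3 q3E] := @rat_in_itvoo R (y - d) y ltac:(by rewrite ltrBlDr ltrDl).
  have [q4 q4E] := @rat_in_itvoo R y (y + d) ltac:(by rewrite ltrDl).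
  move: q1E q2E q3E q4E; rewrite !in_itv/=.
  move=> /andP[a1 a2] /andP[b1 b2] /andP[c1 c2] /andP[d1 d2].
  exists ((q1, q2), (q3, q4)) => //; rewrite /F ifT; last first.
    apply/asboolP => -[z t] [/=]; rewrite !in_itv/= => /andP[z1 z2] /andP[t1 t2].
    apply: UVA; split => /=.
      by apply: xU; rewrite /ball/= ltr_norml; apply/andP; split; lra.
    by apply: yV; rewrite /ball/= ltr_norml; apply/andP; split; lra.
  by split; rewrite /= in_itv/=; apply/andP; split.
apply: countable_bigcupT_measurable => [|q]; first exact: countableP.
rewrite /F; case: ifPn => // _.
by apply: measurableX; exact: measurable_itv.
Qed.

(** Continuity is asked only at the points of [D]: the integrands may blow up at the origin, which
    [D] will avoid. *)
Lemma open_continuous_measurable_plane (D : set (R * R)) (f : R * R -> R) :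
  open D -> {in D, continuous f} -> measurable_fun D f.
Proof.
move=> oD cf; apply: (measurability _ (RGenOInfty.measurableE R)) => //.
move=> _ [_ [a ->] <-]; apply: open_measurable_plane.
rewrite openE => p [Dp fp]; rewrite /interior.
apply: filterI; first exact: open_nbhs_nbhs.
apply: (cf p); first by rewrite inE.
exact: open_nbhs_nbhs.
Qed.

End plane_measurability.

(** * The logarithm and the Poisson kernel on the interval [-1, 1] *)

Section log_singularity.
Context {R : realType}.
Local Notation mu := (@lebesgue_measure R).

Lemma is_derive_xlnx (x : R) : 0 < x ->
  is_derive x 1 (fun x => 2 * x - x * ln x) (1 - ln x).
Proof.
move=> x0; have ? := is_derive1_ln x0.
apply: is_derive_eq; rewrite /GRing.scale/=; field; lra.
Qed.

(** The antiderivative [2 x - x ln x] is nonnegative at [a] and equals 2 at 1, so the bound does not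
    depend on [a], as monotone convergence to the punctured interval requires. *)
Lemma itv_integral_ln_le (a : R) : 0 < a -> a < 1 ->
  (\int[mu]_(x in `[a, 1%R]) (1 - ln `|x|)%:E <= 2%:E)%E.
Proof.
move=> a0 a1.
have pos x : x \in `[a, 1]%R -> 0 < x by rewrite in_itv/= => /andP[/(lt_le_trans a0)].
have der x : 0 < x -> derivable (fun x : R => 2 * x - x * ln x) x 1.
  by move=> /is_derive_xlnx[].
have cf x : 0 < x -> {for x, continuous (fun x : R => 2 * x - x * ln x)}.
  by move=> /der/derivable1_diffP/differentiable_continuous.
under eq_integral.
  by move=> x; rewrite inE => /pos x0; rewrite (gtr0_norm x0); over.
rewrite (@continuous_FTC2 _ _ (fun x => 2 * x - x * ln x))//.
- rewrite ln1 mulr0 subr0 mulr1 -EFinB lee_fin opprB.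
  by have := ln_le0 (ltW a1); nra.
- apply: derivable_within_continuous => x /pos x0.
  by have ? := is_derive1_ln x0; apply: derivableB => //; apply: ex_derive.
- split => [x /subset_itv_oo_cc/pos/der//||].
    by apply: cvg_at_right_filter; apply: cf.
  by apply: cvg_at_left_filter; apply: cf.
- by move=> x /subset_itv_oo_cc/pos/is_derive_xlnx[_]; rewrite derive1E.
Qed.

Lemma itv_integral_ln_le_neg (a : R) : 0 < a -> a < 1 ->
  (\int[mu]_(x in `[(-1)%R, (- a)%R]) (1 - ln `|x|)%:E <= 2%:E)%E.
Proof.
move=> a0 a1; have := itv_integral_ln_le a0 a1.
rewrite integration_by_substitution_oppr ?(ltW a1)//.
  by under [in X in _ -> X]eq_integral do rewrite /= normrN.
apply: continuous_in_subspaceT => x; rewrite inE/= in_itv/= => /andP[_ xa].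
have x0 : 0 < `|x| by rewrite normr_gt0; lra.
apply: cvgB; first exact: cvg_cst.
exact: (@continuous_comp R R R (@Num.norm _ R) (@ln R) x (@norm_continuous _ _ x) (continuous_ln x0)).
Qed.

Lemma integrable_ln_abs :
  mu.-integrable `[-1, 1] (EFin \o (fun u => 1 - ln `|u| : R)).
Proof.
pose g (u : R) : R := 1 - ln `|u|.
have mg : measurable_fun setT (EFin \o g).
  apply/measurable_EFinP/measurable_funB => //.
  by apply: measurableT_comp; [exact: measurable_ln|exact: normr_measurable].
apply/integrableP; split; first exact: measurable_funTS.
(* These sets exhaust the interval without 0; the index [n.+2] keeps the cut strictly below 1. *)
pose E n : set R := `[-1, - (n.+2%:R^-1)] `|` `[n.+2%:R^-1, 1].
have e0 n : 0 < n.+2%:R^-1 :> R by rewrite invr_gt0.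
have e1 n : n.+2%:R^-1 < 1 :> R by rewrite invf_lt1// ltr1n.
have g0 x : `[-1, 1] x -> 0 <= g x.
  rewrite /= in_itv/= -ler_norml => x1.
  by rewrite subr_ge0 (le_trans (ln_le0 x1)).
have EI n x : E n x -> `[-1, 1] x.
  rewrite /E/= !in_itv/=; have := e0 n; have := e1 n.
  by move: (_^-1) => e ? ? [|] /andP[? ?]; apply/andP; split; lra.
have mE n : measurable (E n) by apply: measurableU; exact: measurable_itv.
have ndE : nondecreasing_seq E.
  apply/nondecreasing_seqP => n; apply/subsetPset => x; rewrite /E/= !in_itv/=.
  have : n.+3%:R^-1 <= n.+2%:R^-1 :> R by rewrite lef_pV2 ?posrE// ler_nat.
  by move: (n.+2%:R^-1) (n.+3%:R^-1) => e d ? [|] /andP[? ?]; [left|right]; apply/andP; split; lra.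
have EB n : (\int[mu]_(x in E n) (g x)%:E <= 4%:E)%E.
  rewrite ge0_integral_setU//=.
  - rewrite (_ : 4 = 2 + 2)%R; last by lra.
    by rewrite EFinD; apply: leeD; [exact: itv_integral_ln_le_neg|exact: itv_integral_ln_le].
  - exact: measurable_funTS.
  - by move=> x /EI; rewrite lee_fin; exact: g0.
  - apply/disj_setPLR => x/=; rewrite !in_itv/= => /andP[_ xe] /andP[ex _].
    by have := le_trans ex xe; have := e0 n; move: (_^-1) => e; lra.
have cE : (\int[mu]_(x in E n) (g x)%:E @[n --> \oo] -->
           \int[mu]_(x in \bigcup_n E n) (g x)%:E)%E.
  apply: ge0_nondecreasing_set_cvg_integral => // [n|n x /EI/g0//].
  exact: measurable_funTS.
have UE : (\int[mu]_(x in \bigcup_n E n) (g x)%:E <= 4%:E)%E.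
  by rewrite -(cvg_lim _ cE)//; apply: lime_le; [apply/cvg_ex; eexists; exact: cE|exact: nearW].
have -> : (\int[mu]_(x in `[(-1)%R, 1%R]) `|(EFin \o g) x| =
           \int[mu]_(x in `[(-1)%R, 1%R]) (g x)%:E)%E.
  by apply: eq_integral => x; rewrite inE => /g0 gx; rewrite /= ger0_norm.
rewrite -(@integral_setD1 _ _ 0); last 2 first.
- by apply: measurableD => //; exact: measurable_itv.
- exact: measurable_funTS.
rewrite (_ : `[(-1)%R, 1%R] `\ 0 = \bigcup_n E n); first exact: le_lt_trans UE (ltry _).
apply/seteqP; split => [x /= [x1 x0]|x [n _ Ex]]; last first.
  split; first exact: EI Ex.
  move=> x0; move: Ex; rewrite x0 /E/= !in_itv/=.
  by have := e0 n; move: (_^-1) => e ? [|] /andP[]; lra.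
have {}x0 : 0 < `|x| by rewrite normr_gt0; exact/eqP.
have [n nx] : exists n, n.+2%:R^-1 < `|x|.
  pose m := Num.truncn `|x|^-1; exists m.
  rewrite invf_plt ?posrE// (lt_le_trans (truncnS_gt _))// ler_nat.
  exact: leqnSn.
exists n => //; rewrite /E /=; move: x1; rewrite !in_itv/=.
move=> /andP[? ?]; case: (lerP 0 x) => sx.
  by right; move: nx; rewrite ger0_norm// => /ltW ->.
by left; move: nx; rewrite ltr0_norm//; move: (_^-1) => e ?; apply/andP; split => //; lra.
Qed.

Lemma integrable_continuous (f : R -> R) (a b : R) : continuous f ->
  mu.-integrable `[a, b] (EFin \o f).
Proof.
move=> cf; apply: continuous_compact_integrable; first exact: segment_compact.
exact: continuous_subspaceT.
Qed.

Lemma Rintegral_FTC (F f : R -> R) (a b : R) : a < b ->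
  (forall x : R, x \in `[a, b]%R -> is_derive x 1 F (f x)) ->
  {within `[a, b], continuous f} ->
  \int[mu]_(x in `[a, b]) f x = F b - F a.
Proof.
move=> ab dF cf.
have ca x : x \in `[a, b]%R -> {for x, continuous F}.
  by move=> /dF[? _]; apply/differentiable_continuous/derivable1_diffP.
rewrite /Rintegral (@continuous_FTC2 _ _ F)//.
- split => [x /subset_itv_oo_cc/dF[]//||].
    by apply: cvg_at_right_filter; apply: ca; rewrite in_itv/= lexx ltW.
  by apply: cvg_at_left_filter; apply: ca; rewrite in_itv/= lexx ltW.
- by move=> x /subset_itv_oo_cc/dF[_]; rewrite derive1E.
Qed.

Lemma continuous_poisson (e : R) : 0 < e ->
  continuous (fun v : R => 2 * e / (e ^+ 2 + v ^+ 2)).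
Proof.
move=> e0 v; apply: cvgM; first exact: cvg_cst.
apply: cvgV; first by rewrite gt_eqF// ltr_pwDl ?exprn_gt0 ?sqr_ge0.
by apply: cvgD; [exact: cvg_cst|exact: exprn_continuous].
Qed.

Lemma Rintegral_poisson (e : R) : 0 < e ->
  \int[mu]_(v in `[-1, 1]) (2 * e / (e ^+ 2 + v ^+ 2)) = 4 * atan e^-1.
Proof.
move=> e0; pose F (v : R) := 2 * atan (v / e).
transitivity (F 1 - F (-1)).
  apply: Rintegral_FTC.
  - lra.
  - move=> v _; have := is_derive1_atan (v / e) => da.
    have dv : is_derive v 1 (fun v : R => v / e) e^-1.
      by apply: is_derive_eq; rewrite /GRing.scale/=; lra.
    have dc := @is_derive1_comp _ atan (fun v : R => v / e) v _ _ da dv.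
    apply: is_derive_eq; rewrite /GRing.scale/=; field.
    by rewrite !gt_eqF// ltr_pwDl ?exprn_gt0 ?sqr_ge0.
  - by apply: continuous_subspaceT; exact: continuous_poisson.
by rewrite /F mulN1r mul1r atanN; lra.
Qed.

Lemma poisson_mass_le (e : R) : 4 * atan e^-1 <= 2 * pi.
Proof. by have := atan_ltpi2 e^-1; lra. Qed.

Lemma cvg_poisson_mass : 4 * atan e^-1 @[e --> 0^'+] --> (2 * pi : R).
Proof.
rewrite (_ : 2 * pi = 4 * (pi / 2)); last by lra.
apply: cvgM; first exact: cvg_cst.
apply: (@cvg_comp _ _ _ (fun e : R => e^-1) atan _ _ _ _ (@cvgy_atan R)).
by apply/(@cvgrVy _ _ _ _ (fun e : R => e)); [exact: nbhs_right_gt|exact: cvg_at_right_filter].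
Qed.

(** The kernel is 2 pi times the Poisson kernel of the half plane, an approximate identity;
    truncating it to [-1, 1] loses a mass that tends to 0. Since [Psi] depends on [e] too, its
    convergence is required jointly in [e] and [v]. *)
Lemma cvg_poisson (Psi : R -> R -> R) (L M : R) :
  (forall e, 0 < e -> continuous (Psi e)) ->
  (forall e v, 0 < e -> e < 1 -> `|v| <= 1 -> `|Psi e v| <= M) ->
  (forall eta, 0 < eta -> exists2 d, 0 < d &
     forall e v, 0 < e -> e < d -> `|v| < d -> `|Psi e v - L| <= eta) ->
  \int[mu]_(v in `[-1, 1]) (2 * e / (e ^+ 2 + v ^+ 2) * Psi e v) @[e --> 0^'+]
    --> 2 * pi * L.
Proof.
move=> cPsi PsiM PsiL.
have M0 : 0 <= M.
  by apply: le_trans (normr_ge0 _) (PsiM (2^-1) 0 _ _ _); rewrite ?normr0//; lra.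
pose P (e v : R) := 2 * e / (e ^+ 2 + v ^+ 2).
have P0 e v : 0 < e -> 0 <= P e v.
  by move=> e0; rewrite divr_ge0// ?addr_ge0 ?sqr_ge0// mulr_ge0// ltW.
pose I e := \int[mu]_(v in `[-1, 1]) (P e v * Psi e v).
have iP e : 0 < e -> mu.-integrable `[-1, 1] (EFin \o P e).
  by move=> e0; apply: integrable_continuous; exact: continuous_poisson.
(* Where |v| < d the error is at most [eta] times the mass, which is below 2 pi; elsewhere the
   kernel is at most [2 e / d^2], and the final factor 2 is the length of the interval. *)
have main e d eta : 0 < e -> e < 1 -> e < d -> 0 < d -> 0 < eta ->
    (forall v, `|v| < d -> `|Psi e v - L| <= eta) ->
    `|I e - L * (4 * atan e^-1)| <=
      2 * pi * eta + 2 * e * ((M + `|L|) / d ^+ 2) * 2.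
  move=> e0 e1 ed d0 eta0 H.
  have cPP : continuous (fun v => P e v * Psi e v).
    by move=> v; apply: cvgM; [exact: continuous_poisson|exact: cPsi].
  have cPL : continuous (fun v => L * P e v).
    by move=> v; apply: cvgM; [exact: cvg_cst|exact: continuous_poisson].
  rewrite -(Rintegral_poisson e0) -RintegralZl//; last exact: iP.
  rewrite -RintegralB//; [|exact: integrable_continuous..].
  apply: le_trans; first apply: le_normr_Rintegral => //.
    by apply: integrable_continuous => v; apply: cvgB; [exact: cPP|exact: cPL].
  pose K := (M + `|L|) / d ^+ 2.
  have K0 : 0 <= K by rewrite divr_ge0 ?addr_ge0// sqr_ge0.
  have cB : continuous (fun v => eta * P e v + 2 * e * K).
    move=> v; apply: cvgD; last exact: cvg_cst.
    by apply: cvgM; [exact: cvg_cst|exact: continuous_poisson].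
  apply: (@le_trans _ _ (\int[mu]_(v in `[-1, 1]) (eta * P e v + 2 * e * K))).
    apply: le_Rintegral => //.
    - apply: integrable_continuous => v; apply: cvg_norm.
      by apply: cvgB; [exact: cPP|exact: cPL].
    - exact: integrable_continuous.
    move=> v; rewrite /= in_itv/= -ler_norml => v1.
    rewrite (mulrC L) -mulrBr normrM (ger0_norm (P0 _ _ e0)).
    have [vd|dv] := ltP `|v| d.
      apply: ler_wpDr; first by rewrite mulr_ge0// mulr_ge0// ltW.
      by rewrite [leRHS]mulrC; apply: ler_wpM2l; [exact: P0|exact: H].
    apply: ler_wpDl; first by apply: mulr_ge0; [exact: ltW|exact: P0].
    have Pv : P e v * d ^+ 2 <= 2 * e.
      rewrite /P mulrAC ler_pdivrMr; last first.
        by rewrite ltr_pwDl ?exprn_gt0 ?sqr_ge0.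
      apply: ler_wpM2l; first lra.
      by rewrite -(real_normK (num_real v)) ler_wpDl ?sqr_ge0// lerXn2r ?nnegrE ?(ltW d0).
    have PsM : `|Psi e v - L| <= M + `|L|.
      by apply: le_trans (ler_normB _ _) _; rewrite lerD2r PsiM.
    apply: (@le_trans _ _ (P e v * (M + `|L|))).
      by apply: ler_wpM2l => //; exact: P0.
    rewrite -(_ : K * d ^+ 2 = M + `|L|); last by rewrite /K divfK// gt_eqF ?exprn_gt0.
    by rewrite mulrCA mulrC; apply: ler_wpM2r.
  rewrite RintegralD//; last 2 first.
  - by apply: integrable_continuous => v; apply: cvgM; [exact: cvg_cst|exact: continuous_poisson].
  - by apply: integrable_continuous => v; exact: cvg_cst.
  rewrite RintegralZl//; last exact: iP.
  rewrite Rintegral_poisson// Rintegral_cst//= lebesgue_measure_itv/= lte_fin.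
  rewrite ifT; last lra.
  rewrite -EFinB/= lerD//; last by rewrite -/K; lra.
  by rewrite mulrC ler_wpM2r ?(ltW eta0)// poisson_mass_le.
rewrite -/P.
apply/cvgrPdist_le => eps eps0.
(* Chosen so that [2 pi eta = eps / 4]; the far part and the missing mass cost [eps / 4] each. *)
pose eta := eps / (8 * pi).
have pi0 := pi_gt0 R.
have eta0 : 0 < eta by rewrite divr_gt0// mulr_gt0.
have [d d0 Hd] := PsiL _ eta0.
have cm : L * (4 * atan e^-1) @[e --> 0^'+] --> L * (2 * pi).
  by apply: cvgM; [exact: cvg_cst|exact: cvg_poisson_mass].
have cr : 2 * e * ((M + `|L|) / d ^+ 2) * 2 @[e --> 0^'+] --> (0 : R).
  rewrite [X in _ --> X](_ : _ = 2 * 0 * ((M + `|L|) / d ^+ 2) * 2); last by ring.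
  apply: cvgM; last exact: cvg_cst.
  apply: cvgM; last exact: cvg_cst.
  by apply: cvgM; [exact: cvg_cst|exact: cvg_at_right_filter].
near=> e.
have e0 : 0 < e by near: e; exact: nbhs_right_gt.
have e1 : e < 1 by near: e; apply: nbhs_right_lt.
have ed : e < d by near: e; apply: nbhs_right_lt.
have h1 := main e d eta e0 e1 ed d0 eta0 (fun v => Hd e v e0 ed).
have h2 : `|L * (2 * pi) - L * (4 * atan e^-1)| <= eps / 4.
  by near: e; move/cvgrPdist_le : cm; apply; lra.
have h3 : `|0 - 2 * e * ((M + `|L|) / d ^+ 2) * 2| <= eps / 4.
  by near: e; move/cvgrPdist_le : cr; apply; lra.
have h4 : 2 * pi * eta = eps / 4 by rewrite /eta; field; lra.
move: h3; rewrite sub0r normrN => /(le_trans (ler_norm _)) h3.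
rewrite (mulrC (2 * pi)); apply: le_trans (ler_distD (L * (4 * atan e^-1)) _ _) _.
rewrite distrC in h1.
apply: le_trans (lerD h2 (le_trans h1 (lerD (lexx _) h3))) _.
rewrite h4; clear -eps0; lra.
Unshelve. all: by end_near. Qed.

End log_singularity.

(** * Partial derivatives of a smooth function supported in the disc *)

Section test_function.
Context {R : realType} (rho : R) (phi : R -> R -> R).
Hypothesis sphi : smooth2 phi.
Hypothesis phi0 : forall u v, rho < u ^+ 2 + v ^+ 2 -> phi u v = 0.

Lemma near_sqr_gt (u v : R) : rho < u ^+ 2 + v ^+ 2 ->
  \forall t \near u, rho < t ^+ 2 + v ^+ 2.
Proof.
move=> uv; have c : {for u, continuous (fun t : R => t ^+ 2 + v ^+ 2)}.
  by apply: cvgD; [exact: exprn_continuous|exact: cvg_cst].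
exact: (c _ (lt_nbhsr uv)).
Qed.

(** The strict inequality is an open condition: around such a point the function is identically
    zero, hence so is each further derivative. *)
Lemma pdw_eq0 (l : seq bool) u v : rho < u ^+ 2 + v ^+ 2 -> pdw l phi u v = 0.
Proof.
elim: l u v => [|b l IH] u v uv; first exact: phi0.
rewrite /= /pd; case: b; rewrite derive1E.
  rewrite (@near_eq_derive _ _ _ _ (cst 0)) ?derive_cst// ?oner_neq0//.
  by near=> t; apply: IH; near: t; exact: near_sqr_gt.
rewrite (@near_eq_derive _ _ _ _ (cst 0)) ?derive_cst// ?oner_neq0//.
near=> t; apply: IH; rewrite addrC; near: t; apply: near_sqr_gt.
by rewrite addrC.
Unshelve. all: by end_near. Qed.

Lemma is_derive_pdwl l (u v : R) :
  is_derive u 1 (fun t => pdw l phi t v) (pdw (true :: l) phi u v).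
Proof.
by have [_ /(_ u v)[? _]] := sphi l; split => //; rewrite /= derive1E.
Qed.

Lemma is_derive_pdwr l (u v : R) :
  is_derive v 1 (fun t => pdw l phi u t) (pdw (false :: l) phi u v).
Proof.
by have [_ /(_ u v)[_ ?]] := sphi l; split => //; rewrite /= derive1E.
Qed.

Lemma continuous_pdw l : continuous (fun p : R * R => pdw l phi p.1 p.2).
Proof. by have [] := sphi l. Qed.

(** Continuity gives the bound on a compact square, which contains the support because [rho < 1]. *)
Lemma bounded_pdw (r1 : rho < 1) l :
  exists2 M, 0 <= M & forall u v, `|pdw l phi u v| <= M.
Proof.
have cpt : compact ((`[-1, 1] : set R) `*` (`[-1, 1] : set R)).
  by apply: compact_setX; exact: segment_compact.
have ci := @continuous_compact _ _ _ _
  (continuous_subspaceT (@continuous_pdw l)) cpt.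
have [M [_ MH]] := compact_bounded ci.
exists (`|M| + 1) => [|u v]; first by rewrite addr_ge0.
have [uv|uv] := ltP rho (u ^+ 2 + v ^+ 2).
  by rewrite pdw_eq0// normr0 addr_ge0.
apply: (MH (`|M| + 1)); first by rewrite ltr_pwDr// ler_norm.
exists (u, v) => //; split; rewrite /= in_itv/= -ler_norml.
  by rewrite -(@ler_sqr _ `|u|) ?nnegrE// real_normK ?num_real// expr1n; nra.
by rewrite -(@ler_sqr _ `|v|) ?nnegrE// real_normK ?num_real// expr1n; nra.
Qed.

End test_function.

(** * Radial functions and iterated integrals over rectangles *)

Section radial.
Context {R : realType}.

Unset Implicit Arguments.
Lemma continuous_addf (T : topologicalType) (F G : T -> R) (x : T) :
  {for x, continuous F} -> {for x, continuous G} ->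
  {for x, continuous (fun y => F y + G y)}.
Proof. exact: cvgD. Qed.

Lemma continuous_mulf (T : topologicalType) (F G : T -> R) (x : T) :
  {for x, continuous F} -> {for x, continuous G} ->
  {for x, continuous (fun y => F y * G y)}.
Proof. exact: cvgM. Qed.

Lemma continuous_oppf (T : topologicalType) (F : T -> R) (x : T) :
  {for x, continuous F} -> {for x, continuous (fun y => - F y)}.
Proof. exact: cvgN. Qed.

Lemma continuous_cstf (T : topologicalType) (a : R) (x : T) :
  {for x, continuous (fun=> a)}.
Proof. exact: cvg_cst. Qed.

Set Implicit Arguments.

Lemma continuous_sqn : continuous (@sqn R).
Proof.
by move=> p; apply: cvgD; apply: (@continuous_comp _ _ _ _ (fun x : R => x ^+ 2));
  [exact: cvg_fst|exact: exprn_continuous|exact: cvg_snd|exact: exprn_continuous].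
Qed.

Lemma continuous_pairl (v : R) : continuous (fun u : R => (u, v)).
Proof.
move=> u W [[U V] /= [uU vV] UVW]; apply: filterS uU => w Uw.
by apply: UVW; split => //; exact: nbhs_singleton.
Qed.

Lemma continuous_pairr (u : R) : continuous (fun v : R => (u, v)).
Proof.
move=> v W [[U V] /= [uU vV] UVW]; apply: filterS vV => w Vw.
by apply: UVW; split => //; exact: nbhs_singleton.
Qed.

Lemma continuous_radial (k : R -> R) (p : R * R) :
  {for sqn p, continuous k} -> {for p, continuous (fun p => k (sqn p))}.
Proof. by move=> ck; apply: continuous_comp => //; exact: continuous_sqn. Qed.

Lemma sqr_lt_self (x d : R) : 0 <= x -> x < d -> d <= 1 -> x ^+ 2 < d.
Proof. nra. Qed.

(** With r = sqrt e one has - 2 e ln e = 4 r (- r ln r), and - r ln r <= 1 because ln (1/r) < 1/r.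
    The right-hand side visibly tends to 0 with [e]. *)
Lemma xlnx_le (e : R) : 0 < e -> e * (1 - 2 * ln e) <= e + 4 * Num.sqrt e.
Proof.
move=> e0; have s0 : 0 < Num.sqrt e by rewrite sqrtr_gt0.
have := @ln_sublinear R (Num.sqrt e)^-1; rewrite invr_gt0 => /(_ s0).
rewrite lnV ?posrE// => sl.
have -> : ln e = 2 * ln (Num.sqrt e).
  by rewrite mulr_natl -lnXn// sqr_sqrtr// ltW.
rewrite -{1 3}(sqr_sqrtr (ltW e0)).
have : Num.sqrt e * - ln (Num.sqrt e) <= 1.
  by rewrite -(mulfV (lt0r_neq0 s0)) ler_wpM2l// ltW.
move=> hs; clear sl; move: hs; move: (ln (Num.sqrt e)) => l.
by move: (Num.sqrt e) s0 => s s0 hs; nra.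
Qed.

(** The radial coefficients are controlled only for t < 1. Beyond [rho] the function is locally
    zero, so continuity extends to the whole punctured plane and the unit circle needs no separate
    study. *)
Lemma continuous_radial_supp (rho : R) (F : R * R -> R) : rho < 1 ->
  (forall p, rho < sqn p -> F p = 0) ->
  (forall p, 0 < sqn p -> sqn p < 1 -> {for p, continuous F}) ->
  forall p, 0 < sqn p -> {for p, continuous F}.
Proof.
move=> r1 F0 cF p p0; have [|p1] := ltP (sqn p) 1; first exact: cF.
have rp : rho < sqn p by exact: lt_le_trans p1.
apply: (@near_cst_continuous _ _ 0); near=> p'; apply: F0.
by near: p'; exact: (continuous_sqn (lt_nbhsr rp)).
Unshelve. all: by end_near. Qed.

Lemma is_derive_radial (k : R -> R) (dk u v : R) :
  is_derive (u ^+ 2 + v ^+ 2) 1 k dk ->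
  is_derive u 1 (fun u => k (u ^+ 2 + v ^+ 2)) (2 * u * dk).
Proof.
move=> dk1.
have dg : is_derive u 1 (fun u : R => u ^+ 2 + v ^+ 2) (2 * u).
  by apply: is_derive_eq; rewrite /GRing.scale/= ?expr1; ring.
by have := @is_derive1_comp _ k (fun u : R => u ^+ 2 + v ^+ 2) u _ _ dk1 dg; rewrite mulrC.
Qed.

(** The integrand may be singular outside [D]; on the compact rectangle it is bounded, hence
    integrable for the product measure. *)
Lemma Rintegral_fubini_rect (D : set (R * R)) (F : R * R -> R) (a b c d : R) :
  open D -> {in D, continuous F} -> `[a, b] `*` `[c, d] `<=` D ->
  \int[lebesgue_measure]_(x in `[a, b]) \int[lebesgue_measure]_(y in `[c, d]) F (x, y) =
  \int[lebesgue_measure]_(y in `[c, d]) \int[lebesgue_measure]_(x in `[a, b]) F (x, y).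
Proof.
move=> oD cF sD.
pose mu := @lebesgue_measure R.
set S := `[a, b] `*` `[c, d] in sD.
have mS : measurable S by apply: measurableX; exact: measurable_itv.
have SF : ((mu \x mu)%E S < +oo)%E.
  rewrite product_measure1E//; try exact: measurable_itv.
  by rewrite /mu lte_mul_pinfty// ?ge0_fin_numE//; apply: compact_finite_measure; exact: segment_compact.
have iF : (mu \x mu)%E.-integrable S (EFin \o F).
  apply: measurable_bounded_integrable => //.
    by apply: measurable_funS sD _; [exact: open_measurable_plane|exact: open_continuous_measurable_plane].
  have cS : compact S by apply: compact_setX; exact: segment_compact.
  have ci : {within S, continuous F}.
    by apply: continuous_in_subspaceT => p /set_mem/sD Dp; apply: cF; exact: mem_set.
  have [M [Mr MH]] := compact_bounded (continuous_compact ci cS).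
  exists M; split => // x Mx p Sp /=; exact: MH.
have iS : (mu \x mu)%E.-integrable setT ((EFin \o F) \_ S).
  by have [+ _] := integrable_mkcond (mu := (mu \x mu)%E) (EFin \o F) mS; exact.
have slice1 x : `[a, b] x -> mu.-integrable `[c, d] (EFin \o (fun y => F (x, y))).
  move=> abx; apply: continuous_compact_integrable; first exact: segment_compact.
  apply: continuous_in_subspaceT => y /set_mem cdy.
  apply: (@continuous_comp _ _ _ (fun y => (x, y)) F); last first.
    by apply: cF; apply: mem_set; exact: sD.
  exact: continuous_pairr.
have slice2 y : `[c, d] y -> mu.-integrable `[a, b] (EFin \o (fun x => F (x, y))).
  move=> cdy; apply: continuous_compact_integrable; first exact: segment_compact.
  apply: continuous_in_subspaceT => x /set_mem abx.
  apply: (@continuous_comp _ _ _ (fun x => (x, y)) F); last first.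
    by apply: cF; apply: mem_set; exact: sD.
  exact: continuous_pairl.
have E1 : (\int[mu]_x \int[mu]_y ((EFin \o F) \_ S) (x, y) =
    \int[mu]_(x in `[a, b]) (\int[mu]_(y in `[c, d]) F (x, y))%R%:E)%E.
  rewrite [RHS]integral_mkcond; apply: eq_integral => x _.
  rewrite [RHS]patchE; case: ifPn => abx.
    rewrite /Rintegral fineK; last exact: integrable_fin_num (slice1 _ (set_mem abx)).
    rewrite [RHS]integral_mkcond; apply: eq_integral => y _.
    by rewrite !patchE /S; congr (if _ then _ else _); rewrite in_setX/= abx.
  apply: integral0_eq => y _; rewrite patchE ifF//.
  by rewrite in_setX/= (negbTE abx).
have E2 : (\int[mu]_y \int[mu]_x ((EFin \o F) \_ S) (x, y) =
    \int[mu]_(y in `[c, d]) (\int[mu]_(x in `[a, b]) F (x, y))%R%:E)%E.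
  rewrite [RHS]integral_mkcond; apply: eq_integral => y _.
  rewrite [RHS]patchE; case: ifPn => cdy.
    rewrite /Rintegral fineK; last exact: integrable_fin_num (slice2 _ (set_mem cdy)).
    rewrite [RHS]integral_mkcond; apply: eq_integral => x _.
    by rewrite !patchE /S; congr (if _ then _ else _); rewrite in_setX/= cdy andbT.
  apply: integral0_eq => x _; rewrite patchE ifF//.
  by rewrite in_setX/= (negbTE cdy) andbF.
by rewrite [LHS]/Rintegral [RHS]/Rintegral -E1 -E2 Fubini.
Qed.

End radial.

Lemma measurable_disc (R : realType) : measurable (@disc R).
Proof.
apply: open_measurable_plane.
apply: (@open_comp _ _ (@sqn R) [set t | t < 1]) => [p _|]; last exact: open_lt.
exact: continuous_sqn.
Qed.

(** * Green's identity with a logarithmic singularity at the origin *)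

Section green_identity.
Context {R : realType} (rho : R) (phi : R -> R -> R) (h h1 h2 q q1 : R -> R).
Context (M c : R).
Hypothesis M0 : 0 <= M.
Hypothesis rho1 : rho < 1.
Hypothesis sphi : smooth2 phi.
Hypothesis phi0 : forall u v, rho < u ^+ 2 + v ^+ 2 -> phi u v = 0.
Hypothesis dh : forall t : R, 0 < t -> t < 1 -> is_derive t 1 h (h1 t).
Hypothesis dh1 : forall t : R, 0 < t -> t < 1 -> is_derive t 1 h1 (h2 t).
Hypothesis dq : forall t : R, 0 < t -> t < 1 -> is_derive t 1 q (q1 t).
Hypothesis ch2 : forall t : R, 0 < t -> t < 1 -> {for t, continuous h2}.
Hypothesis cq1 : forall t : R, 0 < t -> t < 1 -> {for t, continuous q1}.
Hypothesis hM : forall t : R, 0 < t -> t <= rho -> `|h t| <= M * (1 - ln t).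
Hypothesis qM : forall t : R, 0 < t -> t <= rho -> `|q t| <= M * (1 - ln t).
Hypothesis lM : forall t : R, 0 < t -> t <= rho ->
  `|h1 t + t * h2 t| <= M * (1 - ln t).
Hypothesis kM : forall t : R, 0 < t -> t <= rho -> `|t * h1 t| <= M.
Hypothesis limk : t * h1 t @[t --> 0^'+] --> c.

Local Notation mu := (@lebesgue_measure R).
Local Notation "'phi_ l" := (pdw l phi) (at level 8, l at level 2, format "''phi_' l").
Local Notation D1 := [:: true].
Local Notation D2 := [:: false].
Local Notation D11 := [:: true; true].
Local Notation D22 := [:: false; false].

(* The integrand [f] is the divergence of the field [(A, B)] off the origin. *)
Let f (u v : R) : R := let t := u ^+ 2 + v ^+ 2 in
  - h t * ('phi_D11 u v + 'phi_D22 u v) + 4 * (h1 t + t * h2 t) * phi u v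
  + q t * (u * 'phi_D2 u v - v * 'phi_D1 u v).
Let A (u v : R) : R := let t := u ^+ 2 + v ^+ 2 in
  - h t * 'phi_D1 u v + 2 * u * h1 t * phi u v - v * q t * phi u v.
Let B (u v : R) : R := let t := u ^+ 2 + v ^+ 2 in
  - h t * 'phi_D2 u v + 2 * v * h1 t * phi u v + u * q t * phi u v.
Let dA (u v : R) : R := let t := u ^+ 2 + v ^+ 2 in
  - h t * 'phi_D11 u v + (2 * h1 t + 4 * u ^+ 2 * h2 t) * phi u v
  - v * (2 * u * q1 t * phi u v + q t * 'phi_D1 u v).
Let dB (u v : R) : R := let t := u ^+ 2 + v ^+ 2 in
  - h t * 'phi_D22 u v + (2 * h1 t + 4 * v ^+ 2 * h2 t) * phi u v
  + u * (2 * v * q1 t * phi u v + q t * 'phi_D2 u v).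

Let pd0 l u v : rho < u ^+ 2 + v ^+ 2 -> 'phi_l u v = 0.
Proof. exact: (pdw_eq0 phi0). Qed.

(** The field is phi grad h - h grad phi + q phi (-v, u), with Laplacian 4 (h1 + t h2) of the radial
    function h. The cross terms h1 grad phi cancel, and so do the terms in [q1], since a rotation
    field with radial coefficient is divergence free. *)
Let fE u v : f u v = dA u v + dB u v.
Proof.
rewrite /f /dA /dB.
move: ('phi_D11 u v) ('phi_D22 u v) ('phi_D1 u v) ('phi_D2 u v) (phi u v) => a b a' b' d.
by move: (h _) (h1 _) (h2 _) (q _) (q1 _) => *; ring.
Qed.

Let f0 u v : rho < u ^+ 2 + v ^+ 2 -> f u v = 0.
Proof. by move=> uv; rewrite /f phi0// !pd0//; ring. Qed.
Let A0 u v : rho < u ^+ 2 + v ^+ 2 -> A u v = 0.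
Proof. by move=> uv; rewrite /A phi0// !pd0//; ring. Qed.
Let B0 u v : rho < u ^+ 2 + v ^+ 2 -> B u v = 0.
Proof. by move=> uv; rewrite /B phi0// !pd0//; ring. Qed.
Let dA0 u v : rho < u ^+ 2 + v ^+ 2 -> dA u v = 0.
Proof. by move=> uv; rewrite /dA phi0// !pd0//; ring. Qed.
Let dB0 u v : rho < u ^+ 2 + v ^+ 2 -> dB u v = 0.
Proof. by move=> uv; rewrite /dB phi0// !pd0//; ring. Qed.

Let ch (t : R) : 0 < t -> t < 1 -> {for t, continuous h}.
Proof. by move=> t0 /(dh t0)[? _]; apply/differentiable_continuous/derivable1_diffP. Qed.
Let ch1 (t : R) : 0 < t -> t < 1 -> {for t, continuous h1}.
Proof. by move=> t0 /(dh1 t0)[? _]; apply/differentiable_continuous/derivable1_diffP. Qed.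
Let cq (t : R) : 0 < t -> t < 1 -> {for t, continuous q}.
Proof. by move=> t0 /(dq t0)[? _]; apply/differentiable_continuous/derivable1_diffP. Qed.

Local Notation "F [+] G" := (continuous_addf _ _ _ _ F G) (at level 50, left associativity).
Local Notation "F [-] G" := (continuous_addf _ _ _ _ F (continuous_oppf _ _ _ G))
  (at level 50, left associativity).
Local Notation "F [*] G" := (continuous_mulf _ _ _ _ F G) (at level 40, left associativity).
Local Notation "[-] F" := (continuous_oppf _ _ _ F) (at level 35).
Local Notation K a := (continuous_cstf _ a _).
Unset Implicit Arguments.
Let c1 (p : R * R) : {for p, continuous (fun p : R * R => p.1)}.
Proof. exact: cvg_fst. Qed.
Let c2 (p : R * R) : {for p, continuous (fun p : R * R => p.2)}.
Proof. exact: cvg_snd. Qed.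
Let cp l (p : R * R) : {for p, continuous (fun p : R * R => 'phi_l p.1 p.2)}.
Proof. exact: continuous_pdw. Qed.
Let cs (p : R * R) : {for p, continuous (fun p : R * R => sqn p)}.
Proof. exact: continuous_sqn. Qed.

Set Implicit Arguments.

Let cf p : 0 < sqn p -> {for p, continuous (fun p => f p.1 p.2)}.
Proof.
apply: (continuous_radial_supp rho1) => [{}p /f0//|{}p p0 p1]; rewrite /f.
have ra k := @continuous_radial _ k p.
have H := ra _ (ch p0 p1); have H1 := ra _ (ch1 p0 p1); have H2 := ra _ (ch2 p0 p1).
have Q := ra _ (cq p0 p1); have Q1 := ra _ (cq1 p0 p1).
exact ([-] H [*] (cp D11 p [+] cp D22 p) [+] K 4 [*] (H1 [+] cs p [*] H2) [*] cp [::] p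
  [+] Q [*] (c1 p [*] cp D2 p [-] c2 p [*] cp D1 p)).
Qed.

Let cA p : 0 < sqn p -> {for p, continuous (fun p => A p.1 p.2)}.
Proof.
apply: (continuous_radial_supp rho1) => [{}p /A0//|{}p p0 p1]; rewrite /A.
have ra k := @continuous_radial _ k p.
have H := ra _ (ch p0 p1); have H1 := ra _ (ch1 p0 p1); have H2 := ra _ (ch2 p0 p1).
have Q := ra _ (cq p0 p1); have Q1 := ra _ (cq1 p0 p1).
exact ([-] H [*] cp D1 p [+] K 2 [*] c1 p [*] H1 [*] cp [::] p [-] c2 p [*] Q [*] cp [::] p).
Qed.

Let cdA p : 0 < sqn p -> {for p, continuous (fun p => dA p.1 p.2)}.
Proof.
apply: (continuous_radial_supp rho1) => [{}p /dA0//|{}p p0 p1]; rewrite /dA.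
have ra k := @continuous_radial _ k p.
have H := ra _ (ch p0 p1); have H1 := ra _ (ch1 p0 p1); have H2 := ra _ (ch2 p0 p1).
have Q := ra _ (cq p0 p1); have Q1 := ra _ (cq1 p0 p1).
exact ([-] H [*] cp D11 p [+] (K 2 [*] H1 [+] K 4 [*] (c1 p [*] c1 p) [*] H2) [*] cp [::] p
  [-] c2 p [*] (K 2 [*] c1 p [*] Q1 [*] cp [::] p [+] Q [*] cp D1 p)).
Qed.

Let cdB p : 0 < sqn p -> {for p, continuous (fun p => dB p.1 p.2)}.
Proof.
apply: (continuous_radial_supp rho1) => [{}p /dB0//|{}p p0 p1]; rewrite /dB.
have ra k := @continuous_radial _ k p.
have H := ra _ (ch p0 p1); have H1 := ra _ (ch1 p0 p1); have H2 := ra _ (ch2 p0 p1).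
have Q := ra _ (cq p0 p1); have Q1 := ra _ (cq1 p0 p1).
exact ([-] H [*] cp D22 p [+] (K 2 [*] H1 [+] K 4 [*] (c2 p [*] c2 p) [*] H2) [*] cp [::] p
  [+] c1 p [*] (K 2 [*] c2 p [*] Q1 [*] cp [::] p [+] Q [*] cp D2 p)).
Qed.

Let deriveA (u v : R) : 0 < u ^+ 2 + v ^+ 2 -> is_derive u 1 (A ^~ v) (dA u v).
Proof.
move=> t0; have [t1|t1] := ltP (u ^+ 2 + v ^+ 2) 1; last first.
  have rt : rho < u ^+ 2 + v ^+ 2 by exact: lt_le_trans t1.
  rewrite dA0//; apply: (@near_eq_is_derive _ _ _ (cst 0)).
  by near=> w; rewrite A0//; near: w; exact: near_sqr_gt.
have D := @is_derive_radial R.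
have Dh := D _ _ u v (dh t0 t1).
have Dh1 := D _ _ u v (dh1 t0 t1).
have Dq := D _ _ u v (dq t0 t1).
have Dp : is_derive u 1 (phi ^~ v) ('phi_D1 u v) := is_derive_pdwl sphi [::] u v.
have Dp1 := is_derive_pdwl sphi D1 u v.
rewrite /A /dA; move: ('phi_D1) ('phi_D11) Dp Dp1 => p p1 Dp Dp1.
apply: is_derive_eq; rewrite /GRing.scale /=.
move: (p u v) (p1 u v) (phi u v) => a a' d.
by move: (h _) (h1 _) (h2 _) (q _) (q1 _) => *; ring.
Unshelve. all: by end_near. Qed.

Let deriveB (u v : R) : 0 < u ^+ 2 + v ^+ 2 -> is_derive v 1 (B u) (dB u v).
Proof.
move=> t0; have [t1|t1] := ltP (u ^+ 2 + v ^+ 2) 1; last first.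
  have rt : rho < u ^+ 2 + v ^+ 2 by exact: lt_le_trans t1.
  rewrite dB0//; apply: (@near_eq_is_derive _ _ _ (cst 0)).
  near=> w; rewrite B0// addrC; near: w; apply: near_sqr_gt.
  by rewrite addrC.
have D k dk : is_derive (u ^+ 2 + v ^+ 2) 1 k dk ->
    is_derive v 1 (fun v => k (u ^+ 2 + v ^+ 2)) (2 * v * dk).
  rewrite addrC => /is_derive_radial.
  by under eq_fun do rewrite addrC.
have Dh := D _ _ (dh t0 t1).
have Dh1 := D _ _ (dh1 t0 t1).
have Dq := D _ _ (dq t0 t1).
have Dp : is_derive v 1 (phi u) ('phi_D2 u v) := is_derive_pdwr sphi [::] u v.
have Dp1 := is_derive_pdwr sphi D2 u v.
rewrite /B /dB; move: ('phi_D2) ('phi_D22) Dp Dp1 => p p1 Dp Dp1.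
apply: is_derive_eq; rewrite /GRing.scale /=.
move: (p u v) (p1 u v) (phi u v) => a a' d.
by move: (h _) (h1 _) (h2 _) (q _) (q1 _) => *; ring.
Unshelve. all: by end_near. Qed.

Let sqn_gt0 (u v : R) : u != 0 -> 0 < u ^+ 2 + v ^+ 2.
Proof. by move=> u0; rewrite ltr_pwDl ?sqr_ge0// exprn_even_gt0. Qed.

Let slice (F : R -> R -> R) (u : R) :
  (forall p, 0 < sqn p -> {for p, continuous (fun p => F p.1 p.2)}) ->
  u != 0 -> continuous (F u).
Proof.
move=> cF u0 v.
exact: (@continuous_comp _ _ _ (fun v : R => (u, v)) (fun p => F p.1 p.2) v
  (@continuous_pairr R u v) (cF (u, v) (sqn_gt0 v u0))).
Qed.

Let slicel (F : R -> R -> R) (u v : R) :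
  (forall p, 0 < sqn p -> {for p, continuous (fun p => F p.1 p.2)}) ->
  u != 0 -> {for u, continuous (F ^~ v)}.
Proof.
move=> cF u0.
exact: (@continuous_comp _ _ _ (fun u : R => (u, v)) (fun p => F p.1 p.2) u
  (@continuous_pairl R v u) (cF (u, v) (sqn_gt0 v u0))).
Qed.

(** On a vertical line avoiding the origin, [B u] vanishes at both ends, which lie outside the
    support; only the flux of [A] will survive. *)
Let Rintegral_dB (u : R) : u != 0 -> \int[mu]_(v in `[-1, 1]) dB u v = 0.
Proof.
move=> u0; transitivity (B u 1 - B u (-1)).
  apply: (@Rintegral_FTC _ (B u)).
  - lra.
  - by move=> v _; apply: deriveB; exact: sqn_gt0.
  - by apply: continuous_subspaceT; exact: slice cdB u0.
by rewrite !B0 ?subrr// ?sqrrN expr1n (lt_le_trans rho1)// lerDr sqr_ge0.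
Qed.

(** Integrating in [v] first removes [dB]; exchanging the order then lets [dA] be integrated in [u].
    The condition on [a] and [b] keeps the rectangle off the line u = 0. *)
Let Rintegral_rect (a b : R) : a < b -> (0 < a) || (b < 0) ->
  \int[mu]_(u in `[a, b]) \int[mu]_(v in `[-1, 1]) f u v =
  \int[mu]_(v in `[-1, 1]) A b v - \int[mu]_(v in `[-1, 1]) A a v.
Proof.
move=> ab ab0.
have n0 u : `[a, b] u -> u != 0.
  rewrite /= in_itv/= => /andP[au ub]; case/orP : ab0 => ?; first by rewrite gt_eqF//; lra.
  by rewrite lt_eqF//; lra.
have -> : \int[mu]_(u in `[a, b]) \int[mu]_(v in `[-1, 1]) f u v =
    \int[mu]_(u in `[a, b]) \int[mu]_(v in `[-1, 1]) dA u v.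
  apply: eq_Rintegral => u /set_mem/n0 u0.
  under eq_Rintegral do rewrite fE.
  rewrite RintegralD//.
  - by rewrite Rintegral_dB// addr0.
  - by apply: integrable_continuous; exact: slice cdA u0.
  - by apply: integrable_continuous; exact: slice cdB u0.
rewrite (@Rintegral_fubini_rect _ [set p | 0 < sqn p] (fun p => dA p.1 p.2))/=; last 3 first.
- apply: (@open_comp _ _ (@sqn R) [set t | 0 < t]) => [p _|]; last exact: open_gt.
  exact: continuous_sqn.
- by move=> p; rewrite inE/= => p0; exact: cdA.
- by move=> [u v] [/n0 u0 _]; exact: sqn_gt0.
have n0a : `[a, b] a by rewrite /= in_itv/= lexx ltW.
have n0b : `[a, b] b by rewrite /= in_itv/= lexx ltW.
rewrite -RintegralB//.
- apply: eq_Rintegral => v _; apply: (@Rintegral_FTC _ (A ^~ v)) => //.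
    by move=> u /n0 u0; apply: deriveA; exact: sqn_gt0.
  apply: continuous_in_subspaceT => u /set_mem/n0 u0.
  exact: slicel cdA u0.
- by apply: integrable_continuous; exact: slice cA (n0 _ n0b).
- by apply: integrable_continuous; exact: slice cA (n0 _ n0a).
Qed.


Let IA (u : R) : R := \int[mu]_(v in `[-1, 1]) A u v.
Let J (u : R) : R := \int[mu]_(v in `[-1, 1]) f u v.
Let F (p : R * R) : \bar R := (f p.1 p.2)%:E.

Let supp_le1 (u v : R) : u ^+ 2 + v ^+ 2 <= rho -> `|u| <= 1 /\ `|v| <= 1.
Proof.
move=> uv; have := sqr_ge0 u; have := sqr_ge0 v => v0 u0.
have t1 := le_trans uv (ltW rho1).
split; rewrite -(@ler_sqr _ _ 1) ?nnegrE// real_normK ?num_real// expr1n.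
  by apply: le_trans t1; rewrite lerDl.
by apply: le_trans t1; rewrite lerDr.
Qed.

(** Trades the singularity at a point of the plane for one in [u] alone, so that integrability
    reduces to that of a logarithm on the line. *)
Let ln_sqr_ge (u v : R) : u != 0 -> 2 * ln `|u| <= ln (u ^+ 2 + v ^+ 2).
Proof.
move=> u0; rewrite mulr_natl -lnXn ?normr_gt0// real_normK ?num_real//.
rewrite ler_ln ?posrE ?sqn_gt0// ?exprn_even_gt0//.
by rewrite lerDl sqr_ge0.
Qed.

Let f_bound : exists2 W, 0 <= W &
  forall u v : R, u != 0 -> `|u| <= 1 -> `|f u v| <= W * (1 - ln `|u|).
Proof.
have bd := bounded_pdw sphi phi0 rho1.
have [m0 m00 H0] := bd [::]; have [m1 m10 H1] := bd D1; have [m2 m20 H2] := bd D2.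
have [m11 m110 H11] := bd D11; have [m22 m220 H22] := bd D22.
(* The factor 2 comes from 1 - 2 ln |u| <= 2 (1 - ln |u|); the other factors bound [phi] and its
   derivatives, using |u|, |v| <= 1 on the support. *)
exists (2 * M * (m11 + m22 + 4 * m0 + m2 + m1)) => [|u v u0 u1].
  by rewrite !mulr_ge0// !addr_ge0// mulr_ge0.
have l0 : 0 <= 1 - ln `|u| by rewrite subr_ge0 (le_trans (ln_le0 u1)).
have [uv|uv] := ltP rho (u ^+ 2 + v ^+ 2).
  by rewrite f0// normr0 mulr_ge0// !mulr_ge0// !addr_ge0// mulr_ge0.
have t0 := sqn_gt0 v u0; have [_ v1] := supp_le1 uv.
set L := 1 - ln `|u| in l0 *.
have key (x : R) : x <= M * (1 - ln (u ^+ 2 + v ^+ 2)) -> x <= 2 * M * L.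
  move=> /le_trans; apply; rewrite (mulrC 2) -mulrA; apply: ler_wpM2l => //.
  by have := ln_sqr_ge v u0; rewrite /L; move: (ln _) (ln _) => ? ?; lra.
have hL := key _ (hM t0 uv); have qL := key _ (qM t0 uv); have lL := key _ (lM t0 uv).
rewrite /f; set t := _ + _ in hL qL lL *.
have b1 : `|h t * ('phi_D11 u v + 'phi_D22 u v)| <= 2 * M * L * (m11 + m22).
  rewrite normrM; apply: ler_pM => //.
  by apply: le_trans (ler_normD _ _) _; exact: lerD.
have b2 : `|(h1 t + t * h2 t) * phi u v| <= 2 * M * L * m0.
  by rewrite normrM; apply: ler_pM => //; exact: (H0 u v).
have b3 : `|q t * (u * 'phi_D2 u v - v * 'phi_D1 u v)| <= 2 * M * L * (m2 + m1).
  rewrite normrM; apply: ler_pM => //.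
  apply: le_trans (ler_normB _ _) _; rewrite !normrM; apply: lerD.
    by rewrite -[m2]mul1r; apply: ler_pM.
  by rewrite -[m1]mul1r; apply: ler_pM.
rewrite mulNr -[4 * _ * _]mulrA.
apply: le_trans (ler_normD _ _) _.
apply: (@le_trans _ _ (2 * M * L * (m11 + m22) + 4 * (2 * M * L * m0) + 2 * M * L * (m2 + m1))).
  apply: lerD => //; apply: le_trans (ler_normD _ _) _; rewrite normrN; apply: lerD => //.
  by rewrite normrM ger0_norm// ler_wpM2l.
by rewrite le_eqVlt; apply/orP; left; apply/eqP; ring.
Qed.

Let measurable_F : measurable_fun setT F.
Proof.
apply/measurable_EFinP.
(* The value of [f] at the origin is arbitrary; a single point is measurable on its own. *)
have -> : [set: R * R] = [set p | 0 < sqn p] `|` [set (0, 0)].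
  apply/seteqP; split => // -[u v] _ /=; rewrite /sqn/=.
  have [->|u0] := eqVneq u 0; last by left; exact: sqn_gt0.
  have [->|v0] := eqVneq v 0; first by right.
  by left; rewrite addrC; exact: sqn_gt0.
have oD : open [set p : R * R | 0 < sqn p].
  apply: (@open_comp _ _ (@sqn R) [set t | 0 < t]) => [p _|]; last exact: open_gt.
  exact: continuous_sqn.
apply/measurable_funU.
- exact: open_measurable_plane.
- rewrite (_ : [set (0, 0)] = [set 0] `*` [set 0]).
    by apply: measurableX; exact: measurable_set1.
  by apply/seteqP; split => [_ ->//|[u v] [/= -> ->]].
- split; last exact: measurable_fun_set1.
  by apply: open_continuous_measurable_plane => // p; rewrite inE; exact: cf.
Qed.

Let square_integrable (W : R) : 0 <= W ->
  (mu \x mu)%E.-integrable setT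
    ((fun p => (W * (1 - ln `|p.1|))%:E) \_ (`[-1, 1] `*` `[-1, 1])).
Proof.
move=> W0; set S := _ `*` _; pose g (p : R * R) := (W * (1 - ln `|p.1|))%:E.
rewrite -/g.
have mS : measurable S by apply: measurableX; exact: measurable_itv.
have mg : measurable_fun setT g.
  apply/measurable_EFinP; apply: measurable_funM => //; apply: measurable_funB => //.
  have m1 : measurable_fun setT (fun p : R * R => p.1) by exact: measurable_fst.
  have m2 : measurable_fun setT (fun p : R * R => `|p.1|).
    by apply: measurableT_comp m1; exact: normr_measurable.
  by apply: measurableT_comp m2; exact: measurable_ln.
have mG : measurable_fun setT (g \_ S).
  by apply/(measurable_restrictT _ mS); exact: measurable_funS mg.
have iW1 : mu.-integrable `[-1, 1]
    (fun x => W%:E * (EFin \o (fun u => (1 - ln `|u|)%R : R)) x)%E.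
  by apply: integrableZl => //; exact: integrable_ln_abs.
have iW2 : mu.-integrable `[-1, 1] (fun x => (W * (1 - ln `|x|))%:E).
  by apply: eq_integrable iW1 => // x _; rewrite /= EFinM.
have iW : mu.-integrable `[-1, 1] (fun x => (W * (1 - ln `|x|))%:E * 2%:E)%E.
  by apply: integrableZr iW2.
refine ((integrable12ltyP mu mu _).2 _); first exact: mG.
have [_] := integrableP _ _ _ iW; apply: le_lt_trans.
rewrite [leRHS]integral_mkcond le_eqVlt; apply/orP; left; apply/eqP; apply: eq_integral.
move=> x _; rewrite patchE; case: ifPn => x1.
  rewrite (_ : (fun y => `|(g \_ S) (x, y)|%E) =
               ((fun=> `|(W * (1 - ln `|x|))%:E|%E) \_ `[-1, 1])); last first.
    apply/funext => y; rewrite !patchE /S in_setX/= x1/=.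
    by case: ifPn => // _; rewrite abse0.
  rewrite -integral_mkcond integral_cst//= lebesgue_measure_itv/= lte_fin ifT; last lra.
  by rewrite opprK [in RHS]normrM normr_nat EFinM -EFinD.
rewrite integral0_eq// => y _; rewrite patchE ifF ?abse0//.
by rewrite /S in_setX/= (negbTE x1).
Qed.

Let integrable_F : (mu \x mu)%E.-integrable setT F.
Proof.
have [W W0 fW] := f_bound.
(* The logarithmic bound is available only for u != 0, and this line is a null set. *)
pose N : set (R * R) := [set 0] `*` setT.
have mN : measurable N by apply: measurableX => //; exact: measurable_set1.
have muN : (mu \x mu)%E N = 0.
  transitivity (mu [set 0%R] * mu setT)%E; first exact: product_measure1E.
  by rewrite lebesgue_measure_set1 mul0e.
apply: (negligible_integrable (mu := (mu \x mu)%E) mN measurableT measurable_F muN).2.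
have mD : measurable (setT `\` N) by exact: measurableD.
have gI := square_integrable W0.
have {}gI := integrableS (mu := (mu \x mu)%E) measurableT mD (@subsetT _ _) gI.
apply: le_integrable gI => //; first exact: measurable_funS measurable_F.
move=> [u v] [_ /= Nuv].
have u0 : u != 0 by apply/eqP => u0; apply: Nuv; rewrite /N/=.
rewrite patchE; case: ifPn => uvS.
  move: uvS; rewrite inE => -[/=]; rewrite in_itv/= -ler_norml => u1 _.
  rewrite lee_fin; apply: le_trans (fW u v u0 u1) _.
  exact: ler_norm.
rewrite abse0 lee_fin f0 ?normr0//; rewrite ltNge; apply/negP => /supp_le1[u1 v1].
by move/negP : uvS; apply; rewrite inE; split; rewrite /= in_itv/= -ler_norml.
Qed.

Let fubini_FE (u : R) : (\int[mu]_v F (u, v) = \int[mu]_(v in `[(-1)%R, 1%R]) (f u v)%:E)%E.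
Proof.
rewrite [RHS]integral_mkcond; apply: eq_integral => v _; rewrite patchE.
case: ifPn => // /negP v1; rewrite /F/= f0// ltNge; apply/negP => /supp_le1[_ ?].
by apply: v1; rewrite inE/= in_itv/= -ler_norml.
Qed.

Let integrable_J : mu.-integrable `[-1, 1] (EFin \o J).
Proof.
have iF := integrable_fubini_F integrable_F.
have mF := measurable_int _ iF.
have JE : EFin \o J = (EFin \o (fine \o fubini_F mu F)).
  by apply/funext => u; rewrite /= /J /Rintegral /fubini_F fubini_FE.
have gI := integrableS (mu := mu) measurableT (measurable_itv `[-1, 1]%R) (@subsetT _ _) iF.
apply: le_integrable gI => //.
- rewrite JE; apply/measurable_EFinP; apply: (measurableT_comp (fine_measurable measurableT)).
  exact: measurable_funS mF.
- have fin (x : \bar R) : (`|(fine x)%:E| <= `|x|)%E by case: x => [r||]; rewrite //= ?leey.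
  by move=> u _; rewrite JE; exact: fin.
Qed.

Let integral_F : \int[(mu \x mu)%E]_p f p.1 p.2 = \int[mu]_(u in `[-1, 1]) J u.
Proof.
rewrite [LHS]/Rintegral [RHS]/Rintegral; congr fine.
rewrite -(integral12_prod_meas1 integrable_F).
have -> : (\int[mu]_x fubini_F mu F x = \int[mu]_(x in `[(-1)%R, 1%R]) fubini_F mu F x)%E.
  rewrite [RHS]integral_mkcond; apply: eq_integral => u _; rewrite patchE.
  case: ifPn => // /negP u1; rewrite /fubini_F integral0_eq// => v _.
  rewrite /F/= f0// ltNge; apply/negP => /supp_le1[? _].
  by apply: u1; rewrite inE/= in_itv/= -ler_norml.
have mD : measurable (`[-1, 1] `\ 0 : set R) by apply: measurableD.
(* At u = 0 the slice is not known to be continuous, so its integral is not known to be finite and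
   may differ from its real value [J]; that one point is discarded. *)
rewrite -(@integral_setD1 _ _ 0) => //; last first.
  exact: measurable_funS (measurable_int _ (integrable_fubini_F integrable_F)).
rewrite -[RHS](@integral_setD1 _ _ 0) => //; last first.
  by apply: measurable_funS (measurable_int _ integrable_J) => // u [].
apply: eq_integral => u; rewrite inE => -[_ /= /eqP u0].
rewrite /fubini_F fubini_FE /J /Rintegral fineK//.
have iu : mu.-integrable `[-1, 1] (EFin \o f u).
  by apply: integrable_continuous; exact: slice cf u0.
exact: integrable_fin_num iu.
Qed.


Let Rintegral_J (a b : R) : a < b -> (0 < a) || (b < 0) ->
  \int[mu]_(u in `[a, b]) J u = IA b - IA a.
Proof. exact: Rintegral_rect. Qed.

Let IA_eq0 (u : R) : 1 <= `|u| -> IA u = 0.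
Proof.
move=> u1; rewrite /IA; under eq_Rintegral.
  move=> v _; rewrite A0; last first.
    rewrite ltNge; apply/negP => uv; have [u1' _] := supp_le1 uv.
    move: uv; rewrite -(real_normK (num_real u)) (_ : `|u| = 1).
      by rewrite expr1n; move=> ht; have := le_lt_trans ht rho1; rewrite ltNge lerDl sqr_ge0.
    by apply/le_anti; rewrite u1 u1'.
  over.
by rewrite Rintegral_cst// mul0r.
Qed.

(** Since [J] is integrable, its integral over [-1, x] is continuous in x, so the strip |u| < e
    contributes nothing in the limit. Outside the strip the integral is a difference of fluxes,
    those at u = -1 and u = 1 being zero. *)
Let cvg_IA_total :
  IA (- e) - IA e @[e --> 0^'+] --> \int[mu]_(u in `[-1, 1]) J u.
Proof.
pose P x := \int[mu]_(u in `[-1, x]) J u.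
have N11 : -1 < 1 :> R by lra.
have := parameterized_integral_continuous (ltW N11) integrable_J.
move=> /(continuous_within_itvP _ N11)[+ _ _] => /(_ 0).
have zin : (0 : R) \in `](-1), 1[%R by rewrite in_itv/=; apply/andP; split; lra.
rewrite zin => /(_ isT) cP.
have cP1 : P e @[e --> 0^'+] --> P 0 by exact: cvg_at_right_filter.
have cP2 : P (- e) @[e --> 0^'+] --> P 0.
  apply: cvg_at_right_filter; rewrite -[X in P X]oppr0.
  apply: (@continuous_comp _ _ _ (fun e : R => - e) P 0); last by rewrite oppr0.
  exact: opp_continuous.
have cPP : P 1 - P e + P (- e) @[e --> 0^'+] --> P 1.
  rewrite -[X in _ --> X](_ : P 1 - P 0 + P 0 = P 1); last by rewrite subrK.
  by apply: cvgD => //; apply: cvgB => //; exact: cvg_cst.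
apply: cvg_trans cPP; apply: near_eq_cvg; near=> e.
have e0 : 0 < e by near: e; exact: nbhs_right_gt.
have e1 : e < 1 by near: e; apply: nbhs_right_lt.
have iJ (a b : R) : -1 <= a -> b <= 1 -> mu.-integrable `[a, b] (EFin \o J).
  move=> a1 b1; apply: integrableS integrable_J => //.
  by apply: subset_itv; rewrite bnd_simp.
have -> : P (- e) = IA (- e).
  rewrite /P Rintegral_J; last by apply/orP; right; lra.
    by rewrite [IA (-1)]IA_eq0 ?subr0// normrN1.
  lra.
have -> : P 1 - P e = - IA e.
  rewrite /P Rintegral_itvB ?bnd_simp; [|exact: iJ|lra|lra].
  rewrite Rintegral_itv_obnd_cbnd; last first.
    apply: (integrableS _ _ _ integrable_J) => //.
    by apply: subset_itv; rewrite bnd_simp//; lra.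
  by rewrite Rintegral_J ?e0// [IA 1]IA_eq0 ?sub0r// normr1.
by rewrite addrC.
Unshelve. all: by end_near. Qed.

(** In the jump of [A] across the strip, the term 2 u h1 phi is odd in its coefficient, so the two
    sides add up: this is [Psi] against the kernel. The other coefficients are even in u and leave
    differences of [phi] or its derivative, collected in [Err]. *)
Let Psi (e v : R) := (e ^+ 2 + v ^+ 2) * h1 (e ^+ 2 + v ^+ 2) * (phi e v + phi (- e) v).
Let Err (e v : R) := - h (e ^+ 2 + v ^+ 2) * ('phi_D1 e v - 'phi_D1 (- e) v)
  - v * q (e ^+ 2 + v ^+ 2) * (phi e v - phi (- e) v).

Let cPsi (e : R) : 0 < e -> continuous (Psi e).
Proof.
move=> e0; apply: (@slice Psi) (lt0r_neq0 e0).
apply: (continuous_radial_supp rho1) => [[u v] uv|p p0 p1]; rewrite /Psi/=.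
  by rewrite !phi0 ?sqrrN// addr0 mulr0.
have H1 := @continuous_radial _ h1 p (ch1 p0 p1).
have cN : {for p, continuous (fun p : R * R => phi (- p.1) p.2)}.
  apply: (@continuous_comp _ _ _ (fun p : R * R => (- p.1, p.2)) (fun p => phi p.1 p.2)).
    move=> W [[U V] /= [uU vV] UVW].
    have UV : nbhs p (fun x : R * R => U (- x.1) /\ V x.2).
      by apply: filterI; [exact: (continuous_oppf _ _ _ (c1 p)) uU|exact: (c2 p) vV].
    change (nbhs p (fun x : R * R => W (- x.1, x.2))).
    by apply: filterS UV => x [? ?]; exact: UVW.
  exact (cp [::] (- p.1, p.2)).
exact (cs p [*] H1 [*] (cp [::] p [+] cN)).
Qed.

Let PsiM (m e v : R) : (forall u v, `|phi u v| <= m) -> 0 < e -> `|Psi e v| <= M * (2 * m).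
Proof.
move=> Hm e0; have m0 : 0 <= m by apply: le_trans (Hm 0 0).
rewrite /Psi; have [uv|uv] := ltP rho (e ^+ 2 + v ^+ 2).
  by rewrite !phi0 ?sqrrN// addr0 mulr0 normr0 mulr_ge0// mulr_ge0.
rewrite normrM; apply: ler_pM => //; first exact: kM (sqn_gt0 v (lt0r_neq0 e0)) uv.
by apply: le_trans (ler_normD _ _) _; rewrite mulr2n mulrDl mul1r; apply: lerD; exact: (Hm _ _).
Qed.

Let PsiL (eta : R) : 0 < eta -> exists2 d, 0 < d &
  forall e v, 0 < e -> e < d -> `|v| < d -> `|Psi e v - 2 * c * phi 0 0| <= eta.
Proof.
have [m0 m00 Hm0] := bounded_pdw sphi phi0 rho1 [::].
(* The error splits into (c - k) times a sum bounded by 2 m0, and |c| times at most 2 eps; the 1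
   makes the denominator positive. *)
move=> eta0; pose eps := eta / (2 * m0 + 2 * `|c| + 1).
have den0 : 0 < 2 * m0 + 2 * `|c| + 1 by rewrite ltr_wpDl// addr_ge0// mulr_ge0.
have eps0 : 0 < eps by rewrite divr_gt0.
have /cvgrPdist_le/(_ _ eps0) := limk; rewrite near_withinE => -[d1 /= d10 Hd1].
have /cvgrPdist_le/(_ _ eps0) := @continuous_pdw R phi sphi [::] (0, 0).
move=> -[[U V] /= [/nbhs_ballP[d2 /= d20 H2] /nbhs_ballP[d3 /= d30 H3]] HUV].
(* Since d <= 1, both squares are below d and t < 2 d <= d1, which is why [d1] is halved. *)
pose d := Num.min 1 (Num.min (d1 / 2) (Num.min d2 d3)).
have dle : [/\ d <= 1, d <= d1 / 2, d <= d2 & d <= d3].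
  by rewrite /d; split; rewrite !ge_min lexx ?orbT.
have [dl1 dl2 dl3 dl4] := dle.
exists d; first by rewrite /d !lt_min d20 d30 ltr01 divr_gt0.
move=> e v e0 ed vd.
have ball0 (x r : R) : `|x| < r -> ball 0 r x by rewrite /ball/= sub0r normrN.
have Hs (x : R) : `|x| < d -> `|phi 0 0 - phi x v| <= eps.
  move=> xd; apply: (HUV (x, v)); split => /=.
    by apply: H2; apply: ball0; exact: lt_le_trans dl3.
  by apply: H3; apply: ball0; exact: lt_le_trans dl4.
have t0 : 0 < e ^+ 2 + v ^+ 2 by exact: sqn_gt0 (lt0r_neq0 e0).
have td : e ^+ 2 + v ^+ 2 < d1.
  have a1 : e ^+ 2 < d by apply: sqr_lt_self => //; exact: ltW.
  have a2 : v ^+ 2 < d by rewrite -(real_normK (num_real v)); exact: sqr_lt_self.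
  apply: lt_le_trans (ltrD a1 a2) _; rewrite -[d1]divr1.
  by apply: le_trans (lerD dl2 dl2) _; rewrite divr1 -splitr.
have Hk : `|c - (e ^+ 2 + v ^+ 2) * h1 (e ^+ 2 + v ^+ 2)| <= eps.
  by apply: Hd1 => //=; rewrite sub0r normrN gtr0_norm.
rewrite /Psi; set k := _ * h1 _ in Hk *.
have s1 : `|phi 0 0 - phi e v| <= eps by apply: Hs; rewrite gtr0_norm.
have s2 : `|phi 0 0 - phi (- e) v| <= eps by apply: Hs; rewrite normrN gtr0_norm.
have -> : k * (phi e v + phi (- e) v) - 2 * c * phi 0 0 =
    - (c - k) * (phi e v + phi (- e) v)
    - c * ((phi 0 0 - phi e v) + (phi 0 0 - phi (- e) v)).
  by move: (phi e v) (phi (- e) v) (phi 0 0) => x y z; ring.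
apply: le_trans (ler_normB _ _) _; rewrite !normrM normrN.
apply: (@le_trans _ _ (eps * (2 * m0) + `|c| * (2 * eps))).
  apply: lerD; [apply: ler_pM => //|apply: ler_wpM2l => //].
    apply: le_trans (ler_normD _ _) _; rewrite mulr2n mulrDl mul1r.
    by apply: lerD; exact: (Hm0 _ _).
  by apply: le_trans (ler_normD _ _) _; rewrite mulr2n mulrDl mul1r; apply: lerD.
rewrite [leRHS](_ : eta = eps * (2 * m0 + 2 * `|c| + 1)); last by rewrite /eps divfK// gt_eqF.
rewrite -subr_ge0 (_ : _ - _ = eps) ?ltW//.
by move: (`|c|) (eps) => w x; ring.
Qed.

Let AE (e v : R) : 0 < e ->
  A e v - A (- e) v = 2 * e / (e ^+ 2 + v ^+ 2) * Psi e v + Err e v.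
Proof.
move=> e0; rewrite /A /Psi /Err sqrrN mulrA [2 * e / _ * _]mulrA divfK; last first.
  by rewrite gt_eqF ?sqn_gt0// lt0r_neq0.
move: ('phi_D1 e v) ('phi_D1 (- e) v) (phi e v) (phi (- e) v) => a b a' b'.
by move: (h _) (h1 _) (q _) => *; ring.
Qed.

Let mvt l m (e v : R) : (forall u v, `|'phi_(true :: l) u v| <= m) -> 0 < e ->
  `|'phi_l e v - 'phi_l (- e) v| <= m * (2 * e).
Proof.
move=> Hm e0.
have [||x _ ->] := @MVT_segment R (fun u => 'phi_l u v) (fun u => 'phi_(true :: l) u v)
    (- e) e _ (fun x _ => is_derive_pdwl sphi l x v).
- by rewrite ge0_cp ?ltW.
- apply: derivable_within_continuous => x _.
  by have [] := is_derive_pdwl sphi l x v.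
- rewrite normrM opprK (_ : e + e = 2 * e); last by ring.
  rewrite (ger0_norm (_ : 0 <= 2 * e)); last by rewrite mulr_ge0// ltW.
  by apply: ler_wpM2r; [rewrite mulr_ge0// ltW|exact: Hm].
Qed.

Let cErr (e : R) : 0 < e -> continuous (Err e).
Proof.
move=> e0.
have -> : Err e = fun v => A e v - A (- e) v - 2 * e / (e ^+ 2 + v ^+ 2) * Psi e v.
  by apply/funext => v; rewrite AE// addrC addKr.
have e1 : e != 0 by rewrite gt_eqF.
have e2 : - e != 0 by rewrite oppr_eq0.
move=> v; apply: cvgB; first by apply: cvgB; exact: slice cA _ _.
by apply: cvgM; [exact: continuous_poisson|exact: cPsi].
Qed.

(** By the mean value theorem the differences are O(e), while [h] and [q] are at most M (1 - 2 ln e)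
    because t >= e^2; the product tends to 0 uniformly in [v]. *)
Let cvg_Err : \int[mu]_(v in `[-1, 1]) Err e v @[e --> 0^'+] --> (0 : R).
Proof.
have bd := bounded_pdw sphi phi0 rho1.
have [m1 m10 Hm1] := bd D1; have [m11 m110 Hm11] := bd D11.
pose C := M * (2 * m11 + 2 * m1).
have C0 : 0 <= C by rewrite mulr_ge0// addr_ge0// mulr_ge0.
have ErrM (e v : R) : 0 < e -> e < 1 -> `|v| <= 1 -> `|Err e v| <= C * (e * (1 - 2 * ln e)).
  move=> e0 e1 v1; rewrite /Err.
  have le0 : 0 <= 1 - 2 * ln e.
    by rewrite subr_ge0 (@le_trans _ _ 0)// mulr_ge0_le0// ln_le0// ltW.
  have [uv|uv] := ltP rho (e ^+ 2 + v ^+ 2).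
    rewrite !phi0 ?pd0 ?sqrrN// !subr0 !mulr0 subr0 normr0.
    by rewrite mulr_ge0// mulr_ge0// ltW.
  have t0 : 0 < e ^+ 2 + v ^+ 2 by exact: sqn_gt0 (lt0r_neq0 e0).
  have key (x : R) : x <= M * (1 - ln (e ^+ 2 + v ^+ 2)) -> x <= M * (1 - 2 * ln e).
    move=> /le_trans; apply; apply: ler_wpM2l => //; apply: lerB => //.
    by have := ln_sqr_ge v (lt0r_neq0 e0); rewrite gtr0_norm.
  have hL := key _ (hM t0 uv); have qL := key _ (qM t0 uv).
  have d1 := mvt v Hm11 e0; have d0 : `|phi e v - phi (- e) v| <= _ := mvt v Hm1 e0.
  apply: le_trans (ler_normB _ _) _.
  rewrite [leRHS](_ : _ = M * (1 - 2 * ln e) * (m11 * (2 * e)) + M * (1 - 2 * ln e) * (m1 * (2 * e))); last first.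
    by rewrite /C; move: (ln e) => l; ring.
  rewrite !normrM normrN; apply: lerD; first exact: ler_pM.
  apply: ler_pM => //.
  by rewrite -[leRHS]mul1r; apply: ler_pM.
have bnd (e : R) : 0 < e -> e < 1 ->
    `|\int[mu]_(v in `[-1, 1]) Err e v| <= C * (e + 4 * Num.sqrt e) * 2.
  move=> e0 e1.
  apply: le_trans; first apply: le_normr_Rintegral => //.
    by apply: integrable_continuous; exact: cErr.
  have -> : C * (e + 4 * Num.sqrt e) * 2 =
      \int[mu]_(v in `[-1, 1]) (C * (e + 4 * Num.sqrt e)).
    rewrite Rintegral_cst//= lebesgue_measure_itv/= lte_fin ifT; last by rewrite gtrN ?ltr01.
    by rewrite -EFinB/=; congr (_ * _); rewrite opprK.
  apply: le_Rintegral => //.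
  - by apply: integrable_continuous => v; apply: cvg_norm; exact: cErr.
  - by apply: integrable_continuous => v; exact: cvg_cst.
  move=> v; rewrite /= in_itv/= -ler_norml => v1.
  by apply: le_trans (ErrM e v e0 e1 v1) _; apply: ler_wpM2l => //; exact: xlnx_le.
have lim0 : C * (e + 4 * Num.sqrt e) * 2 @[e --> 0^'+] --> (0 : R).
  rewrite [X in _ --> X](_ : _ = C * (0 + 4 * Num.sqrt 0) * 2); last by rewrite sqrtr0; ring.
  apply: cvgM; last exact: cvg_cst.
  apply: cvgM; first exact: cvg_cst.
  apply: cvgD; first exact: cvg_at_right_filter.
  apply: cvgM; first exact: cvg_cst.
  by apply: cvg_at_right_filter; exact: sqrt_continuous.
apply/cvgrPdist_le => eps eps0; near=> e.
have e0 : 0 < e by near: e; exact: nbhs_right_gt.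
have e1 : e < 1 by near: e; apply: nbhs_right_lt.
rewrite sub0r normrN; apply: le_trans (bnd e e0 e1) _.
rewrite (le_trans (ler_norm _))// -normrN -sub0r.
by near: e; move/cvgrPdist_le : lim0; apply.
Unshelve. all: by end_near. Qed.

(** The kernel has mass 2 pi and the two faces of the strip contribute [c phi(0)] each; the sign is
    that of the outward normal, which points into the strip. *)
Let cvg_IA : IA (- e) - IA e @[e --> 0^'+] --> - (4 * pi * c * phi 0 0).
Proof.
have [m0 m00 Hm0] := bounded_pdw sphi phi0 rho1 [::].
have lim := cvg_poisson cPsi (fun e v e0 _ _ => PsiM v Hm0 e0) PsiL.
rewrite [X in _ --> X](_ : _ = - (2 * pi * (2 * c * phi 0 0) + 0)); last first.
  by move: (phi 0 0) => x; ring.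
have lim2 : - (\int[mu]_(v in `[-1, 1]) (2 * e / (e ^+ 2 + v ^+ 2) * Psi e v) +
    \int[mu]_(v in `[-1, 1]) Err e v) @[e --> 0^'+] -->
    - (2 * pi * (2 * c * phi 0 0) + 0).
  by apply: cvgN; apply: cvgD; [exact: lim|exact: cvg_Err].
apply: cvg_trans lim2; apply: near_eq_cvg; near=> e.
have e0 : 0 < e by near: e; exact: nbhs_right_gt.
have e1 : e != 0 by rewrite gt_eqF.
have e2 : - e != 0 by rewrite oppr_eq0.
have cP : continuous (fun v : R => 2 * e / (e ^+ 2 + v ^+ 2) * Psi e v).
  by move=> v; apply: cvgM; [exact: continuous_poisson|exact: cPsi].
rewrite -[RHS]opprB /= -RintegralD//; last 2 first.
- exact: integrable_continuous.
- by apply: integrable_continuous; exact: cErr.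
congr (- _); rewrite /IA -RintegralB//; last 2 first.
- by apply: integrable_continuous; exact: slice cA _.
- by apply: integrable_continuous; exact: slice cA _.
by apply: eq_Rintegral => v _; rewrite AE.
Unshelve. all: by end_near. Qed.

Let supp_disc : (fun p => f p.1 p.2) = (fun p => f p.1 p.2) \_ (@disc R).
Proof.
apply/funext => -[u v]; rewrite patchE; case: ifPn => // /negP uv.
rewrite f0// ltNge; apply/negP => uv'; apply: uv.
by rewrite inE /disc/= /sqn/=; exact: le_lt_trans uv' rho1.
Qed.

Lemma green_identity :
  (mu \x mu)%E.-integrable (@disc R) (fun p => (f p.1 p.2)%:E) /\
  \int[(mu \x mu)%E]_(p in @disc R) f p.1 p.2 = - (4 * pi * c * phi 0 0).
Proof.
have mdisc := @measurable_disc R.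
split.
  by apply: (integrableS _ _ _ integrable_F).
rewrite Rintegral_mkcond -supp_disc integral_F.
exact: (cvg_unique _ cvg_IA_total cvg_IA).
Qed.

End green_identity.

(** * Complex limits, derivatives and powers; Gauss's product for Gamma *)

Section complex_calculus.
Context {R : realType}.
Local Notation C := (R[i]%C).
Local Notation Re := complex.Re.
Local Notation Im := complex.Im.
Implicit Types (z w : C) (u : nat -> C) (f g : R -> C).

Lemma ReD z w : Re (z + w) = Re z + Re w.
Proof. by case: z; case: w. Qed.
Lemma ImD z w : Im (z + w) = Im z + Im w.
Proof. by case: z; case: w. Qed.
Lemma ReN z : Re (- z) = - Re z.
Proof. by case: z. Qed.
Lemma ImN z : Im (- z) = - Im z.
Proof. by case: z. Qed.
Lemma ReM z w : Re (z * w) = Re z * Re w - Im z * Im w.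
Proof. by case: z; case: w. Qed.
Lemma ImM z w : Im (z * w) = Re z * Im w + Im z * Re w.
Proof. by case: z => a b; case: w. Qed.

Lemma complexP z w : Re z = Re w -> Im z = Im w -> z = w.
Proof. by case: z => a b; case: w => c d /= -> ->. Qed.

(** The norm of [R[i]] takes values in [R[i]]; real estimates call for a real modulus. *)
Definition cmod z : R := Num.sqrt (Re z ^+ 2 + Im z ^+ 2).

Lemma cmodE z : `|z| = ((cmod z)%:C)%C.
Proof. by rewrite normc_def. Qed.

Lemma cmodM z w : cmod (z * w) = cmod z * cmod w.
Proof.
by apply: (@complexI R); rewrite -cmodE normrM !cmodE rmorphM.
Qed.

Lemma cmodD z w : cmod (z + w) <= cmod z + cmod w.
Proof. by rewrite -lecR rmorphD/= -!cmodE ler_normD. Qed.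

Lemma cmodN z : cmod (- z) = cmod z.
Proof. by rewrite /cmod ReN ImN !sqrrN. Qed.

Lemma cmod_ge0 z : 0 <= cmod z.
Proof. exact: sqrtr_ge0. Qed.

Lemma cmod_gt0 z : (0 < cmod z) = (z != 0).
Proof. by rewrite -ltcR -cmodE normr_gt0. Qed.

Lemma Re_le_cmod z : `|Re z| <= cmod z.
Proof. by rewrite -sqrtr_sqr ler_wsqrtr// lerDl sqr_ge0. Qed.

Lemma Im_le_cmod z : `|Im z| <= cmod z.
Proof. by rewrite -sqrtr_sqr ler_wsqrtr// lerDr sqr_ge0. Qed.

Lemma cmod_le z : cmod z <= `|Re z| + `|Im z|.
Proof.
rewrite -(@ler_sqr _ (cmod z)) ?nnegrE ?cmod_ge0 ?addr_ge0//.
rewrite /cmod sqr_sqrtr ?addr_ge0 ?sqr_ge0// sqrrD !real_normK ?num_real//.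
by rewrite lerD2r lerDl mulrn_wge0// mulr_ge0.
Qed.

(** Convergence by components, the notion that [climn] computes. *)
Definition ccvg u z := (Re (u n) @[n --> \oo] --> Re z) /\ (Im (u n) @[n --> \oo] --> Im z).

Lemma ccvg_climn u z : ccvg u z -> climn u = z.
Proof.
by case=> ur ui; apply: complexP => /=; apply/cvg_lim.
Qed.

Lemma ccvgM u v z w : ccvg u z -> ccvg v w -> ccvg (fun n => u n * v n) (z * w).
Proof.
move=> [ur ui] [vr vi]; split.
  under eq_fun do rewrite ReM; rewrite ReM.
  by apply: cvgB; exact: cvgM.
under eq_fun do rewrite ImM; rewrite ImM.
by apply: cvgD; exact: cvgM.
Qed.

Lemma ccvgV u z : z != 0 -> ccvg u z -> ccvg (fun n => (u n)^-1) z^-1.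
Proof.
move=> z0 [ur ui].
have inv w : w^-1 = (Re w / (Re w ^+ 2 + Im w ^+ 2) +i* (- Im w / (Re w ^+ 2 + Im w ^+ 2)))%C.
  by case: w => a b /=; rewrite mulNr.
have d0 : Re z ^+ 2 + Im z ^+ 2 != 0.
  apply: contra_neq z0 => /eqP; rewrite paddr_eq0 ?sqr_ge0// !sqrf_eq0 => /andP[/eqP ? /eqP ?].
  exact: complexP.
have cd : (Re (u n) ^+ 2 + Im (u n) ^+ 2)^-1 @[n --> \oo] --> (Re z ^+ 2 + Im z ^+ 2)^-1.
  by apply: cvgV => //; apply: cvgD; exact: cvgM.
split; (under eq_fun do rewrite inv/=); rewrite inv/=; apply: cvgM => //.
exact: cvgN.
Qed.

Lemma cexpD z w : cexp (z + w) = cexp z * cexp w.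
Proof.
rewrite /cexp ReD ImD expRD cosD sinD; apply: complexP; rewrite /= ?ReM ?ImM/=; ring.
Qed.

Lemma cexp0 : cexp (0 : C) = 1.
Proof. by rewrite /cexp/= expR0 cos0 sin0; apply: complexP => /=; ring. Qed.

Lemma cmod_cexp z : cmod (cexp z) = expR (Re z).
Proof.
rewrite /cmod /cexp ReM ImM/=.
rewrite (_ : _ + _ = expR (Re z) ^+ 2 * (cos (Im z) ^+ 2 + sin (Im z) ^+ 2)); last by ring.
by rewrite cos2Dsin2 mulr1 sqrtr_sqr ger0_norm// expR_ge0.
Qed.

Lemma cexp_neq0 z : cexp z != 0.
Proof. by rewrite -cmod_gt0 cmod_cexp expR_gt0. Qed.

Lemma cpowRD (x : R) z w : cpowR x (z + w) = cpowR x z * cpowR x w.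
Proof. by rewrite /cpowR mulrDl cexpD. Qed.

Lemma cpowRM (x y : R) z : 0 < x -> 0 < y -> cpowR (x * y) z = cpowR x z * cpowR y z.
Proof. by move=> x0 y0; rewrite /cpowR lnM ?posrE// rmorphD/= mulrDr cexpD. Qed.

Lemma cpow1R z : cpowR 1 z = 1.
Proof. by rewrite /cpowR ln1 mulr0 cexp0. Qed.

Lemma cpowR0 (x : R) : cpowR x 0 = 1.
Proof. by rewrite /cpowR mul0r cexp0. Qed.

Lemma cpowR_neq0 (x : R) z : cpowR x z != 0.
Proof. exact: cexp_neq0. Qed.

Lemma cpowRN (x : R) z : cpowR x (- z) = (cpowR x z)^-1.
Proof.
apply: (mulIf (cpowR_neq0 x z)); rewrite mulVf ?cpowR_neq0//.
by rewrite -cpowRD addNr cpowR0.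
Qed.

Lemma cpowRV (x : R) z : 0 < x -> cpowR x^-1 z = cpowR x (- z).
Proof. by move=> x0; rewrite /cpowR lnV ?posrE// rmorphN/= mulrN mulNr. Qed.

Lemma cpowR1 (x : R) : 0 < x -> cpowR x 1 = (x%:C)%C.
Proof.
move=> x0; rewrite /cpowR mul1r /cexp/= lnK ?posrE// cos0 sin0.
by apply: complexP => /=; ring.
Qed.

Lemma cmod_cpowR (x : R) z : cmod (cpowR x z) = expR (Re z * ln x).
Proof. by rewrite cmod_cexp ReM/= mulr0 subr0. Qed.

Definition cder f (x : R) z :=
  is_derive x 1 (fun x => Re (f x)) (Re z) /\ is_derive x 1 (fun x => Im (f x)) (Im z).

Lemma cder_eq f (x : R) z w : cder f x z -> z = w -> cder f x w.
Proof. by move=> ? <-. Qed.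

Lemma cder_cst w (x : R) : cder (fun=> w) x 0.
Proof. by split; exact: is_derive_cst. Qed.

Lemma cder_real (r : R -> R) (x dr : R) : is_derive x 1 r dr ->
  cder (fun x => (r x)%:C%C) x (dr%:C)%C.
Proof. by move=> ?; split => //=; exact: is_derive_cst. Qed.

Lemma cderD f g (x : R) z w : cder f x z -> cder g x w ->
  cder (fun x => f x + g x) x (z + w).
Proof.
move=> [fr fi] [gr gi]; split.
  by under eq_fun do rewrite ReD; apply: is_derive_eq; rewrite ReD.
by under eq_fun do rewrite ImD; apply: is_derive_eq; rewrite ImD.
Qed.

Lemma cderM f g (x : R) z w : cder f x z -> cder g x w ->
  cder (fun x => f x * g x) x (z * g x + f x * w).
Proof.
move=> [fr fi] [gr gi]; split.
  under eq_fun do rewrite ReM; apply: is_derive_eq.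
  by rewrite /GRing.scale/= !(ReD, ReM); ring.
under eq_fun do rewrite ImM; apply: is_derive_eq.
by rewrite /GRing.scale/= !(ImD, ImM); ring.
Qed.

Lemma cder_comp f (r : R -> R) (x dr : R) z : cder f (r x) z -> is_derive x 1 r dr ->
  cder (fun x => f (r x)) x (z * (dr%:C)%C).
Proof.
move=> [fr fi] dr1; split.
  rewrite ReM/= mulr0 subr0.
  exact: (@is_derive1_comp _ (fun x => Re (f x)) r x _ _ fr dr1).
rewrite ImM/= mulr0 add0r.
exact: (@is_derive1_comp _ (fun x => Im (f x)) r x _ _ fi dr1).
Qed.

Lemma cder_cpowR (x : R) z : 0 < x ->
  cder (fun x => cpowR x z) x (z * cpowR x z * (x^-1%:C)%C).
Proof.
move=> x0; have dl := is_derive1_ln x0.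
have de : cder (fun t : R => cexp (z * (t%:C)%C)) (ln x) (z * cpowR x z).
  have E t : cexp (z * (t%:C)%C) =
      (expR (Re z * t) * cos (Im z * t) +i* (expR (Re z * t) * sin (Im z * t)))%C.
    rewrite /cexp ReM ImM /= !mulr0 subr0 add0r.
    by apply: complexP; rewrite /= ?ReM ?ImM/=; ring.
  have d1 (a t : R) : is_derive t 1 (fun t : R => a * t) a.
    by apply: is_derive_eq; rewrite /GRing.scale/= mulr1.
  have dexp := @is_derive1_comp _ expR _ _ _ _ (is_derive_expR _) (d1 (Re z) (ln x)).
  have dcos := @is_derive1_comp _ cos _ _ _ _ (is_derive_cos _) (d1 (Im z) (ln x)).
  have dsin := @is_derive1_comp _ sin _ _ _ _ (is_derive_sin _) (d1 (Im z) (ln x)).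
  rewrite /cpowR E; split.
    under eq_fun do rewrite E/=.
    by apply: is_derive_eq; rewrite /GRing.scale/= ReM/=; ring.
  under eq_fun do rewrite E/=.
  by apply: is_derive_eq; rewrite /GRing.scale/= ImM/=; ring.
exact: (cder_comp de dl).
Qed.

(* The factor 2 comes from applying the mean value theorem to [Re] and [Im] separately. *)
Lemma cder_bound f (df : R -> C) (K x : R) : 0 <= x ->
  (forall t, 0 <= t -> t <= x -> cder f t (df t)) ->
  (forall t, 0 <= t -> t <= x -> cmod (df t) <= K) ->
  cmod (f x - f 0) <= 2 * K * x.
Proof.
move=> x0 dfx dfK.
have mvt (p : C -> R) : (forall t, 0 <= t -> t <= x -> is_derive t 1 (fun t => p (f t)) (p (df t))) ->
    (forall z, `|p z| <= cmod z) -> `|p (f x) - p (f 0)| <= K * x.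
  move=> dp pm.
  have dpo t : t \in `]0, x[%R -> is_derive t 1 (fun t => p (f t)) (p (df t)).
    by rewrite in_itv/= => /andP[/ltW ? /ltW ?]; exact: dp.
  have [|t] := MVT_segment x0 dpo.
  - apply: derivable_within_continuous => t; rewrite in_itv/= => /andP[? ?].
    by have [] := dp t.
  - rewrite in_itv/= => /andP[? ?] ->.
    rewrite subr0 normrM (ger0_norm x0); apply: ler_wpM2r => //.
    by apply: le_trans (pm _) _; exact: dfK.
apply: le_trans (cmod_le _) _; rewrite !(ReD, ReN, ImD, ImN).
rewrite (_ : 2 * K * x = K * x + K * x); last by ring.
apply: lerD; apply: mvt => [t t0 tx|z].
- by have [] := dfx t t0 tx.
- exact: Re_le_cmod.
- by have [] := dfx t t0 tx.
- exact: Im_le_cmod.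
Qed.


Lemma cvg_of_harmonic_cauchy (u : nat -> R) (K : R) (N0 : nat) :
  (forall N n, (N0 <= N)%N -> (N <= n)%N -> `|u n - u N| <= K * N.+1%:R^-1) ->
  cvgn u.
Proof.
move=> H; have K0 : 0 <= K.
  have := le_trans (normr_ge0 _) (H N0 N0 (leqnn _) (leqnn _)).
  by rewrite pmulr_lge0// invr_gt0.
apply: cauchy_cvg; apply: cauchy_exP => e /= e0.
have e1 : 0 < e / (K + 1) by rewrite divr_gt0// ltr_wpDl.
have [N1 N1e] : exists N1 : nat, forall N, (N1 <= N)%N -> N.+1%:R^-1 < e / (K + 1).
  by have [N1 _ HN] := near_infty_natSinv_lt (PosNum e1); exists N1.
pose N := maxn N0 N1; exists (u N); exists N => // n /= Nn.
rewrite /ball/= distrC; apply: le_lt_trans (H N n (leq_maxl _ _) Nn) _.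
apply: (@le_lt_trans _ _ ((K + 1) * N.+1%:R^-1)).
  by apply: ler_wpM2r; [rewrite invr_ge0|rewrite lerDl].
by rewrite mulrC -ltr_pdivlMr ?ltr_wpDl// N1e// leq_maxr.
Qed.

(** The bound on [e n] telescopes. From a rank [N0] on, the total relative deviation from [p N0] is
    at most 1/2, which yields the Cauchy property and keeps the limit at modulus at least half of
    that of [p N0]. *)
Lemma ccvg_infinite_prod (p : nat -> C) (e : nat -> C) (K : R) :
  0 <= K -> (forall n, p n != 0) -> (forall n, p n.+1 = p n * (1 + e n)) ->
  (forall n, cmod (e n) <= K * (n.+1%:R^-1 - n.+2%:R^-1)) ->
  exists2 l, l != 0 & ccvg p l.
Proof.
move=> K0 p0 pS eK; pose w (n : nat) : R := n.+1%:R^-1.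
have w0 n : 0 <= w n by rewrite invr_ge0.
have wS n : w n.+1 <= w n by rewrite lef_pV2 ?posrE// ler_nat.
have [N0 HN0] : exists N0 : nat, forall N, (N0 <= N)%N -> 2 * K * w N <= 2^-1.
  have e1 : 0 < (4 * (K + 1))^-1 by rewrite invr_gt0 mulr_gt0// ltr_wpDl.
  have [N0 _ HN] := near_infty_natSinv_lt (PosNum e1); exists N0 => N /HN /= /ltW wN.
  apply: le_trans (ler_wpM2l _ wN) _; first by rewrite mulr_ge0.
  have K1 : 0 < K + 1 by rewrite ltr_wpDl.
  rewrite ler_pdivrMr ?mulr_gt0// -subr_ge0 (_ : _ - _ = 2) //; by field.
(* By induction: as long as the relative deviation is at most 1, [p (N + k)] has at most twice the
   modulus of [p N], and this 2 is the one in the bound for the next step. *)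
have claim N k : (N0 <= N)%N -> cmod (p (N + k)%N - p N) <= cmod (p N) * (2 * K * (w N - w (N + k)%N)).
  move=> N0N; elim: k => [|k IH]; first by rewrite addn0 !subrr !mulr0 /cmod/= expr0n/= addr0 sqrtr0.
  have wNk : w (N + k)%N <= w N.
    by rewrite lef_pV2 ?posrE// ler_nat ltnS leq_addr.
  have half : 2 * K * (w N - w (N + k)%N) <= 1.
    apply: le_trans (_ : _ <= 2 * K * w N) _; first by rewrite ler_wpM2l ?mulr_ge0// gerBl.
    by apply: le_trans (HN0 _ N0N) _; rewrite invf_le1// ler1n.
  have big : cmod (p (N + k)%N) <= 2 * cmod (p N).
    rewrite -[p (N + k)%N](subrK (p N)); apply: le_trans (cmodD _ _) _.
    rewrite mulr2n mulrDl mul1r lerD2r; apply: le_trans IH _.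
    by rewrite ler_piMr// cmod_ge0.
  rewrite addnS pS (_ : _ - p N = (p (N + k)%N - p N) + p (N + k)%N * e (N + k)%N); last by ring.
  apply: le_trans (cmodD _ _) _.
  rewrite (_ : _ * (2 * K * _) = cmod (p N) * (2 * K * (w N - w (N + k)%N)) +
    2 * cmod (p N) * (K * (w (N + k)%N - w (N + k).+1))); last by ring.
  by apply: lerD => //; rewrite cmodM; apply: ler_pM; rewrite ?cmod_ge0.
have claim2 N n : (N0 <= N)%N -> (N <= n)%N -> cmod (p n - p N) <= cmod (p N) * (2 * K * w N).
  move=> N0N Nn; rewrite -(subnKC Nn); apply: le_trans (claim _ _ N0N) _.
  by rewrite ler_wpM2l ?cmod_ge0// ler_wpM2l ?mulr_ge0// gerBl.
pose B := 2 * cmod (p N0).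
have pB N : (N0 <= N)%N -> cmod (p N) <= B.
  move=> N0N; rewrite -[p N](subrK (p N0)); apply: le_trans (cmodD _ _) _.
  rewrite /B mulr2n mulrDl mul1r lerD2r; apply: le_trans (claim2 _ _ (leqnn _) N0N) _.
  rewrite ler_piMr ?cmod_ge0//; apply: le_trans (HN0 _ (leqnn _)) _.
  by rewrite invf_le1// ler1n.
have claim3 N n : (N0 <= N)%N -> (N <= n)%N -> cmod (p n - p N) <= B * (2 * K) * N.+1%:R^-1.
  move=> N0N Nn; apply: le_trans (claim2 _ _ N0N Nn) _; rewrite -[leRHS]mulrA.
  by apply: ler_wpM2r; [rewrite !mulr_ge0 ?invr_ge0|exact: pB].
have /cvg_ex[a ca] : cvgn (fun n => Re (p n)).
  apply: (@cvg_of_harmonic_cauchy _ (B * (2 * K)) N0) => N n N0N Nn.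
  by rewrite -ReN -ReD; apply: le_trans (Re_le_cmod _) (claim3 _ _ N0N Nn).
have /cvg_ex[b cb] : cvgn (fun n => Im (p n)).
  apply: (@cvg_of_harmonic_cauchy _ (B * (2 * K)) N0) => N n N0N Nn.
  by rewrite -ImN -ImD; apply: le_trans (Im_le_cmod _) (claim3 _ _ N0N Nn).
exists (a +i* b)%C; last by split.
have cab : Re (p n) ^+ 2 + Im (p n) ^+ 2 @[n --> \oo] --> a ^+ 2 + b ^+ 2.
  by apply: cvgD; exact: cvgM.
have low : (cmod (p N0) / 2) ^+ 2 <= a ^+ 2 + b ^+ 2.
  rewrite -(cvg_lim _ cab)//.
  apply: limr_ge; first by apply/cvg_ex; eexists; exact: cab.
  near=> n.
  have Nn : (N0 <= n)%N by near: n; exact: nbhs_infty_ge.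
  rewrite -[leRHS]sqr_sqrtr ?addr_ge0 ?sqr_ge0// -/(cmod (p n)).
  rewrite lerXn2r ?nnegrE ?divr_ge0 ?cmod_ge0//.
  have : cmod (p N0) <= cmod (p n) + cmod (p n - p N0).
    rewrite -(cmodN (p n - _)) -{1}(_ : p n + - (p n - p N0) = p N0); last by ring.
    exact: cmodD.
  have : cmod (p n - p N0) <= cmod (p N0) * 2^-1.
    apply: le_trans (claim2 _ _ (leqnn _) Nn) _.
    by rewrite ler_wpM2l ?cmod_ge0// HN0.
  by move: (cmod _) (cmod (p n)) (cmod (p n - _)) => x y z; lra.
apply/eqP => -[a0 b0]; move: low; rewrite a0 b0 expr0n/= addr0 leNgt.
by rewrite exprn_gt0// divr_gt0// cmod_gt0.
Unshelve. all: by end_near. Qed.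

(* [Q (1/n)] is the ratio of consecutive terms of Gauss's product for [1/Gamma];
   [Q 0 = 1] and [Q'] vanishes at [0], so [Q x - 1 = O(x^2)]. *)
Let Q z (x : R) : C := (1 + (x%:C)%C * (1 + z)) * cpowR (1 + x) (- (z + 1)).

Let Q_bound z : exists2 K, 0 <= K & forall x : R, 0 <= x -> x <= 1 ->
  cmod (Q z x - 1) <= K * x ^+ 2.
Proof.
(* The exponential bounds the modulus of (1 + t)^(-(z + 2)), since 0 <= ln (1 + t) <= t <= 1. *)
pose K0 := cmod (z * (1 + z)) * expR `|Re (z + 2)|.
have K00 : 0 <= K0 by rewrite mulr_ge0 ?cmod_ge0// expR_ge0.
exists (2 * K0) => [|x x0 x1]; first by rewrite mulr_ge0.
pose dQ (t : R) : C := - (z * (1 + z)) * (t%:C)%C * cpowR (1 + t) (- (z + 2)).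
have <- : Q z 0 = 1 by rewrite /Q mul0r addr0 addr0 cpow1R mulr1.
rewrite (_ : 2 * K0 * x ^+ 2 = 2 * (K0 * x) * x); last by ring.
apply: (@cder_bound _ dQ) => // t t0 tx.
  have t1 : 0 < 1 + t by rewrite ltr_pwDl.
  have d1 : is_derive t 1 (fun t : R => 1 + t) 1.
    rewrite (_ : (fun t : R => 1 + t) = shift 1); first exact: is_derive_shift.
    by apply/funext => y; rewrite /= addrC.
  have := cderM (cderD (cder_cst 1 t) (cderM (cder_real (is_derive_id t 1)) (cder_cst (1 + z) t)))
    (cder_comp (cder_cpowR (- (z + 1)) t1) d1).
  move/cder_eq; apply; rewrite /dQ.
  have T1 : (1 + t%:C)%C != 0 :> C.
    by apply: contraTneq t1 => /(congr1 (@complex.Re _)) /= ->; rewrite ltxx.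
  have -> : - (z + 2) = - (z + 1) + - 1 :> C by ring.
  rewrite cpowRD (cpowRN _ 1) cpowR1// fmorphV/= rmorphD/= rmorph1.
  by move: (cpowR _ _) => c; field.
rewrite /dQ cmodM cmodM cmodN /K0.
have -> : cmod (t%:C)%C = t by rewrite /cmod/= expr0n/= addr0 sqrtr_sqr ger0_norm.
rewrite cmod_cpowR mulrAC; apply: ler_pM => //.
- by rewrite mulr_ge0 ?cmod_ge0 ?expR_ge0.
- apply: ler_wpM2l; first exact: cmod_ge0.
  rewrite ler_expR; apply: le_trans (ler_norm _) _; rewrite normrM ReN normrN.
  rewrite ler_piMr//; rewrite ger0_norm ?ln_ge0 ?lerDl//.
  apply: le_trans (le_ln1Dx _) _; last exact: le_trans x1.
  by rewrite (lt_le_trans _ t0)// ltrN10.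
Qed.

Lemma poch_neq0 z n : (forall m : nat, z != - m%:R) -> poch z n != 0.
Proof.
by move=> z0; rewrite /poch; apply/prodf_neq0 => j _; rewrite addr_eq0.
Qed.

Lemma pochS z n : poch z n.+1 = poch z n * (z + n%:R).
Proof. by rewrite /poch big_ord_recr. Qed.

Definition gauss_term z n : C := (n`!)%:R * cpowR n%:R z / poch z n.+1.

(** The reciprocals of Gauss's terms form a product with factors 1 + O(n^-2), whose limit exists and
    is nonzero. Its inverse being finite and nonzero gives both conclusions at once. *)
Lemma cGammaP z : (forall m : nat, z != - m%:R) ->
  ccvg (gauss_term z) (cGamma z) /\ cGamma z != 0.
Proof.
(* The product starts at the term of index 1, since the ratio of consecutive terms is [Q] at 1/n. *)
move=> z0; pose p n := (gauss_term z n.+1)^-1.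
have nR0 n : n.+1%:R != 0 :> C by rewrite pnatr_eq0.
have p0 n : p n != 0.
  rewrite invr_eq0 mulf_neq0 ?invr_eq0 ?poch_neq0// mulf_neq0 ?cpowR_neq0//.
pose e n := Q z n.+1%:R^-1 - 1.
have [K K0 HK] := Q_bound z.
have pS n : p n.+1 = p n * (1 + e n).
  rewrite /p /gauss_term /e addrC subrK /Q.
  have -> : 1 + n.+1%:R^-1 = n.+2%:R / n.+1%:R :> R.
    by rewrite -[n.+2%:R]natr1 mulrDl mulfV ?pnatr_eq0// mul1r.
  rewrite cpowRM ?invr_gt0// cpowRV// opprK !cpowRN !cpowRD !cpowR1//.
  rewrite factS natrM pochS fmorphV/= !rmorph_nat.
  have f0 : (n.+1`!)%:R != 0 :> C by rewrite pnatr_eq0 -lt0n fact_gt0.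
  have c1 := cpowR_neq0 (n.+1%:R : R) z; have c2 := cpowR_neq0 (n.+2%:R : R) z.
  have ph := poch_neq0 n.+2 z0.
  have zn : z + n.+2%:R != 0 by rewrite addr_eq0.
  move: (cpowR _ _) (cpowR _ _) c1 c2 (poch _ _) ph => a b a0 b0 q q0.
  have -> : n.+2%:R = n.+1%:R + 1 :> C by rewrite natr1.
  have N2 : n.+1%:R + 1 != 0 :> C by rewrite natr1.
  rewrite -[n.+2%:R]natr1 in zn; move: f0 (nR0 n) N2 zn.
  by move: (_`!%:R) => F; move: (n.+1%:R) => N F0 N0 N2 zn; field; do ?[apply/andP; split].
(* For x >= 1, 1/x^2 <= 2 (1/x - 1/(x + 1)), which puts the quadratic bound in telescoping form. *)
have eK n : cmod (e n) <= 2 * K * (n.+1%:R^-1 - n.+2%:R^-1).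
  apply: le_trans (HK _ _ _) _; rewrite ?invr_ge0 ?invf_le1 ?ler1n//.
  rewrite (mulrC 2) -mulrA; apply: ler_wpM2l => //.
  have n1 : 1 <= n.+1%:R :> R by rewrite ler1n.
  rewrite -[n.+2%:R]natr1; move: (n.+1%:R) n1 => x x1.
  rewrite -subr_ge0 (_ : _ - _ = (x - 1) / (x ^+ 2 * (x + 1))); last by field; lra.
  by rewrite divr_ge0 ?subr_ge0// mulr_ge0 ?sqr_ge0//; lra.
have [l l0 cl] := ccvg_infinite_prod (mulr_ge0 (ler0n R 2) K0) p0 pS eK.
have cg : ccvg (gauss_term z) l^-1.
  have [gr gi] := ccvgV l0 cl.
  split; rewrite -cvg_shiftS; (under eq_fun do rewrite -[gauss_term _ _]invrK); exact.
have -> : cGamma z = l^-1 by exact: ccvg_climn.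
by split => //; rewrite invr_eq0.
Qed.

End complex_calculus.

(** * Power series on the open unit interval and Abel's theorem *)

Section power_series.
Context {R : realType}.
Local Notation C := (R[i]%C).
Local Notation Re := complex.Re.
Local Notation Im := complex.Im.
Implicit Types (c : nat -> C) (u : nat -> R).

Lemma is_cvg_pseries_geometric u (M r x : R) : 0 < r -> `|x| < r ->
  (forall n, `|u n| * r ^+ n <= M) -> cvgn (pseries u x).
Proof.
move=> r0 xr H; apply: normed_cvg.
have M0 : 0 <= M by apply: le_trans (H 0%N); rewrite expr0 mulr1.
apply: (@series_le_cvg _ _ (geometric M (`|x| / r))) => [n|n|n|].
- by rewrite normr_ge0.
- by rewrite /geometric/= mulr_ge0// exprn_ge0// divr_ge0// ltW.
- rewrite /geometric/= normrM normrX expr_div_n [leLHS]mulrC [leRHS]mulrCA.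
  apply: ler_wpM2l; first by rewrite exprn_ge0.
  by rewrite ler_pdivlMr ?exprn_gt0.
- apply: is_cvg_geometric_series; rewrite normrM normr_id normfV (gtr0_norm r0).
  by rewrite ltr_pdivrMr// mul1r.
Qed.

Lemma geometric_sum_le (x : R) n : 0 <= x -> x < 1 ->
  \sum_(0 <= i < n) x ^+ i <= (1 - x)^-1.
Proof.
move=> x0 x1; have x1' : 0 < 1 - x by rewrite subr_gt0.
rewrite -[leRHS]mul1r ler_pdivlMr// mulrC.
have -> : (1 - x) * (\sum_(0 <= i < n) x ^+ i) = 1 - x ^+ n.
  elim: n => [|n IH]; first by rewrite big_geq// mulr0 expr0 subrr.
  by rewrite big_nat_recr//= mulrDr IH exprS; ring.
by rewrite gerBl exprn_ge0.
Qed.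

Lemma pseries_le u (M x : R) : (forall n, `|u n| <= M) -> 0 <= x -> x < 1 ->
  `|limn (pseries u x)| <= M / (1 - x).
Proof.
move=> uM x0 x1.
have M0 : 0 <= M by exact: le_trans (uM 0%N).
have bnd n : `|pseries u x n| <= M / (1 - x).
  rewrite /pseries /series/=; apply: le_trans (ler_norm_sum _ _ _) _.
  apply: (@le_trans _ _ (\sum_(0 <= i < n) M * x ^+ i)).
    apply: ler_sum => i _; rewrite normrM normrX (ger0_norm x0).
    by apply: ler_wpM2r => //; exact: exprn_ge0.
  by rewrite -mulr_sumr; apply: ler_wpM2l => //; exact: geometric_sum_le.
have cu : cvgn (pseries u x).
  apply: (@is_cvg_pseries_geometric u M 1) => //; first by rewrite ger0_norm.
  by move=> n; rewrite expr1n mulr1.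
rewrite ler_norml; apply/andP; split.
  by apply: limr_ge => //; apply: nearW => n; have := bnd n; rewrite ler_norml => /andP[].
by apply: limr_le => //; apply: nearW => n; have := bnd n; rewrite ler_norml => /andP[].
Qed.

(** The weights t (1 - t)^n sum to 1 and each tends to 0 with t, so the left-hand side is an average
    of the [u n] in which any finite set of indices loses its mass. *)
Lemma cvg_abel u (l : R) : u n @[n --> \oo] --> l ->
  t * limn (pseries u (1 - t)) @[t --> 0^'+] --> l.
Proof.
move=> ul; pose v n := u n - l.
have [K K0 vK] : exists2 K, 0 < K & forall n, `|v n| <= K.
  have cv : cvgn v by apply/cvg_ex; exists (l - l); apply: cvgB => //; exact: cvg_cst.
  have [M [_ MH]] := cvg_seq_bounded cv.
  exists (`|M| + 1) => [|n]; first by rewrite ltr_wpDl.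
  by apply: MH => //; rewrite ltr_pwDr// ler_norm.
apply/cvgrPdist_le => eps eps0.
have e2 : 0 < eps / 2 by rewrite divr_gt0.
have [N _ HN] : \forall n \near \oo, `|v n| <= eps / 2.
  move/cvgrPdist_le : ul => /(_ _ e2); apply: filterS => n.
  by rewrite distrC.
near=> t.
have t0 : 0 < t by near: t; exact: nbhs_right_gt.
have t1 : t < 1 by near: t; apply: nbhs_right_lt.
(* Makes the first N terms, each at most K, weigh at most eps / 2 after multiplication by t. *)
have tN : t <= eps / 2 / (K * N%:R + 1).
  by near: t; apply: nbhs_right_le; rewrite divr_gt0// ltr_wpDl// mulr_ge0// ltW.
set x := 1 - t.
have x0 : 0 <= x by rewrite subr_ge0 ltW.
have x1 : x < 1 by rewrite /x gtrBl.
have xa : `|x| < 1 by rewrite ger0_norm.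
have cv : cvgn (pseries v x).
  apply: (@is_cvg_pseries_geometric v K 1) => //.
  by move=> n; rewrite expr1n mulr1.
have tx : 1 - x = t by rewrite /x opprB addrC subrK.
have -> : limn (pseries u x) = limn (pseries v x) + l / t.
  have cg := @cvg_geometric_series R l x xa; rewrite tx in cg.
  have -> : pseries u x = fun n => pseries v x n + series (geometric l x) n.
    apply/funext => n; rewrite /pseries /series/= -big_split/=.
    by apply: eq_bigr => i _; rewrite /v -mulrDl subrK.
  by apply/cvg_lim => //; exact: (cvgD cv cg).
rewrite mulrDr (mulrCA t l) divff ?gt_eqF// mulr1 opprD addrCA subrr addr0 normrN.
rewrite normrM (gtr0_norm t0).
have bnd n : `|pseries v x n| <= eps / 2 / t + K * N%:R.
  rewrite /pseries /series/=; apply: le_trans (ler_norm_sum _ _ _) _.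
  apply: (@le_trans _ _ (\sum_(0 <= i < n) (eps / 2 * x ^+ i + (i < N)%:R * K))).
    apply: ler_sum => i _; rewrite normrM normrX (ger0_norm x0).
    have xi : 0 <= x ^+ i by exact: exprn_ge0.
    case: ltnP => iN.
      rewrite mul1r; apply: ler_wpDl.
        by apply: mulr_ge0 => //; rewrite ltW// divr_gt0.
      apply: le_trans (vK i); rewrite ler_piMr// exprn_ile1//; exact: ltW.
    by rewrite mul0r addr0; apply: ler_wpM2r => //; exact: HN.
  rewrite big_split/= -mulr_sumr; apply: lerD.
    by rewrite -tx; apply: ler_wpM2l; [exact: ltW|exact: geometric_sum_le].
  rewrite -mulr_suml mulrC; apply: ler_wpM2l; first exact: ltW.
  rewrite -natr_sum ler_nat.
  elim: n => [|n IH]; first by rewrite big_geq.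
  rewrite big_nat_recr//=; case: ltnP => [nN|]; last by rewrite addn0.
  rewrite addn1; apply: leq_trans nN; rewrite ltnS.
  apply: (@leq_trans (\sum_(0 <= i < n) 1)%N); first by apply: leq_sum => i _; exact: leq_b1.
  by rewrite sum_nat_const_nat muln1 subn0.
have lb : `|limn (pseries v x)| <= eps / 2 / t + K * N%:R.
  rewrite ler_norml; apply/andP; split.
    by apply: limr_ge => //; apply: nearW => n; have := bnd n; rewrite ler_norml => /andP[].
  by apply: limr_le => //; apply: nearW => n; have := bnd n; rewrite ler_norml => /andP[].
apply: le_trans (ler_wpM2l (ltW t0) lb) _.
rewrite mulrDr mulrCA divff ?gt_eqF// mulr1 [leRHS]splitr lerD2l.
have KN : 0 < K * N%:R + 1 by rewrite ltr_wpDl// mulr_ge0// ltW.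
move: tN; rewrite ler_pdivlMr// => /(le_trans _); apply.
by apply: ler_wpM2l; [exact: ltW|rewrite lerDl].
Unshelve. all: by end_near. Qed.

(* Coefficients of a power series with radius of convergence at least 1. *)
Definition subexp c := forall r : R, 0 < r -> r < 1 ->
  exists M, forall n, cmod (c n) * r ^+ n <= M.

Lemma subexp_bounded c (M : R) : (forall n, cmod (c n) <= M) -> subexp c.
Proof.
move=> cM r r0 r1; exists M => n; apply: le_trans (cM n).
by rewrite ler_piMr ?cmod_ge0// exprn_ile1// ltW.
Qed.

(** The factor n is absorbed by enlarging r to r' < 1: Bernoulli's inequality gives n (r'/r - 1) <=
    (r'/r)^n. *)
Lemma subexp_muln c : subexp c -> subexp (fun n => n%:R * c n).
Proof.
move=> cs r r0 r1; pose r' := (1 + r) / 2.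
have r'r : r < r' by rewrite /r' ltr_pdivlMr//; lra.
have r'1 : r' < 1 by rewrite /r' ltr_pdivrMr//; lra.
have r'0 : 0 < r' by exact: lt_trans r'r.
have [M HM] := cs r' r'0 r'1.
pose d := r' / r - 1.
have d0 : 0 < d by rewrite subr_gt0 ltr_pdivlMr// mul1r.
exists (M * d^-1) => n.
have cn : cmod n%:R = n%:R :> R.
  by apply: (@complexI R); rewrite -cmodE normr_nat rmorph_nat.
rewrite cmodM cn (mulrC n%:R) -mulrA.
have bern : n%:R * d <= (r' / r) ^+ n.
  elim: n {cn} => [|n IH]; first by rewrite mul0r expr0.
  have p1 : 1 <= (r' / r) ^+ n.
    by rewrite exprn_ege1// ler_pdivlMr// mul1r ltW.
  rewrite exprS (_ : r' / r = 1 + d); last by rewrite /d; ring.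
  rewrite (_ : r' / r = 1 + d) in IH p1; last by rewrite /d; ring.
  rewrite -natr1 mulrDl mul1r [leRHS]mulrDl mul1r; apply: lerD => //.
  by rewrite ler_peMr// ltW.
have step : n%:R * r ^+ n <= d^-1 * r' ^+ n.
  rewrite -ler_pdivrMl ?invr_gt0// invrK mulrA [d * _]mulrC.
  by rewrite -ler_pdivlMr ?exprn_gt0// -expr_div_n.
apply: le_trans (ler_wpM2l (cmod_ge0 _) step) _.
rewrite mulrCA [leRHS]mulrC; apply: ler_wpM2l => //.
by rewrite invr_ge0 ltW.
Qed.

Lemma subexp_shift c : subexp c -> subexp (fun n => c n.+1).
Proof.
move=> cs r r0 r1; have [M HM] := cs r r0 r1; exists (M / r) => n.
by rewrite ler_pdivlMr// -mulrA -exprSr.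
Qed.

Definition cdiffs c (n : nat) : C := n.+1%:R * c n.+1.

Lemma subexp_cdiffs c : subexp c -> subexp (cdiffs c).
Proof. by move=> /subexp_muln/subexp_shift. Qed.

Definition cseries c (x : R) : C :=
  (limn (pseries (fun n => Re (c n)) x) +i* limn (pseries (fun n => Im (c n)) x))%C.

Lemma subexp_cvg c (x : R) : subexp c -> `|x| < 1 ->
  cvgn (pseries (fun n => Re (c n)) x) /\ cvgn (pseries (fun n => Im (c n)) x).
Proof.
move=> cs x1; pose r := (1 + `|x|) / 2.
have xr : `|x| < r by rewrite /r ltr_pdivlMr//; lra.
have r1 : r < 1 by rewrite /r ltr_pdivrMr//; lra.
have r0 : 0 < r by apply: le_lt_trans xr.
have [M HM] := cs r r0 r1; split; apply: (@is_cvg_pseries_geometric _ M r) => // n.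
  by apply: le_trans (HM n); apply: ler_wpM2r; [rewrite exprn_ge0// ltW|exact: Re_le_cmod].
by apply: le_trans (HM n); apply: ler_wpM2r; [rewrite exprn_ge0// ltW|exact: Im_le_cmod].
Qed.

Lemma ReX_real (z : C) (x : R) n : Re (z * ((x%:C)%C ^+ n)) = Re z * x ^+ n.
Proof. by rewrite -rmorphXn/= ReM/= mulr0 subr0. Qed.

Lemma ImX_real (z : C) (x : R) n : Im (z * ((x%:C)%C ^+ n)) = Im z * x ^+ n.
Proof. by rewrite -rmorphXn/= ImM/= mulr0 add0r. Qed.

Lemma Re_sum (I : Type) (s : seq I) (F : I -> C) : Re (\sum_(i <- s) F i) = \sum_(i <- s) Re (F i).
Proof. by elim/big_rec2 : _ => // i y1 y2 _ <-; rewrite ReD. Qed.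

Lemma Im_sum (I : Type) (s : seq I) (F : I -> C) : Im (\sum_(i <- s) F i) = \sum_(i <- s) Im (F i).
Proof. by elim/big_rec2 : _ => // i y1 y2 _ <-; rewrite ImD. Qed.

Lemma ccvg_cseries c (x : R) : subexp c -> `|x| < 1 ->
  ccvg (fun N => \sum_(0 <= n < N) c n * (x%:C)%C ^+ n) (cseries c x).
Proof.
move=> cs x1; have [cr ci] := subexp_cvg cs x1; split.
  apply: cvg_trans cr; apply: near_eq_cvg; apply: nearW => N.
  by rewrite Re_sum /pseries /series/=; apply: eq_bigr => i _; rewrite ReX_real.
apply: cvg_trans ci; apply: near_eq_cvg; apply: nearW => N.
by rewrite Im_sum /pseries /series/=; apply: eq_bigr => i _; rewrite ImX_real.
Qed.

Lemma ccvg_subexp0 c (x : R) : subexp c -> `|x| < 1 ->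
  ccvg (fun n => c n * (x%:C)%C ^+ n) 0.
Proof.
move=> cs x1; have [cr ci] := subexp_cvg cs x1; split.
  by under eq_fun do rewrite ReX_real; exact: cvg_series_cvg_0 cr.
by under eq_fun do rewrite ImX_real; exact: cvg_series_cvg_0 ci.
Qed.

(** Termwise differentiation asks for convergence of the series and of its first two formal
    derivatives at a point beyond |x|; [subexp] is stable under formal derivation, so the midpoint
    of |x| and 1 serves for all three. *)
Lemma cder_cseries c (x : R) : subexp c -> `|x| < 1 ->
  cder (cseries c) x (cseries (cdiffs c) x).
Proof.
move=> cs x1; pose r := (1 + `|x|) / 2.
have xr : `|x| < r by rewrite /r ltr_pdivlMr//; lra.
have r1 : r < 1 by rewrite /r ltr_pdivrMr//; lra.
have r0 : 0 < r by apply: le_lt_trans xr.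
have rr : `|r| < 1 by rewrite gtr0_norm.
have xr' : `|x| < `|r| by rewrite (gtr0_norm r0).
have cs1 := subexp_cdiffs cs; have cs2 := subexp_cdiffs cs1.
have [a0 b0] := subexp_cvg cs rr; have [a1 b1] := subexp_cvg cs1 rr.
have [a2 b2] := subexp_cvg cs2 rr.
have RE (d : nat -> C) : (fun n => Re (cdiffs d n)) = pseries_diffs (fun n => Re (d n)).
  by apply/funext => n; rewrite /cdiffs /pseries_diffs -(rmorph_nat (real_complex R)) ReM/= mul0r subr0.
have IE (d : nat -> C) : (fun n => Im (cdiffs d n)) = pseries_diffs (fun n => Im (d n)).
  by apply/funext => n; rewrite /cdiffs /pseries_diffs -(rmorph_nat (real_complex R)) ImM/= mul0r addr0.
split => /=.
  by rewrite RE; apply: (@pseries_snd_diffs _ _ r) => //; rewrite -?RE.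
by rewrite IE; apply: (@pseries_snd_diffs _ _ r) => //; rewrite -?IE.
Qed.

End power_series.

(** * The hypergeometric series with c = a + b near x = 1 *)

Section hypergeometric.
Context {R : realType}.
Local Notation C := (R[i]%C).
Local Notation Re := complex.Re.
Local Notation Im := complex.Im.

Lemma ccvg_cst (z : C) : ccvg (fun=> z) z.
Proof. by split; exact: cvg_cst. Qed.

Lemma ccvgD (u v : nat -> C) (z w : C) : ccvg u z -> ccvg v w ->
  ccvg (fun n => u n + v n) (z + w).
Proof.
move=> [ur ui] [vr vi]; split.
  by under eq_fun do rewrite ReD; rewrite ReD; exact: cvgD.
by under eq_fun do rewrite ImD; rewrite ImD; exact: cvgD.
Qed.

Lemma ccvg_unique (u : nat -> C) (z w : C) : ccvg u z -> ccvg u w -> z = w.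
Proof. by move=> /ccvg_climn <- /ccvg_climn. Qed.

Lemma ccvg_bounded (u : nat -> C) (z : C) : ccvg u z -> exists M, forall n, cmod (u n) <= M.
Proof.
move=> [ur ui].
have bd (f : nat -> R) (l : R) : f n @[n --> \oo] --> l -> exists M, forall n, `|f n| <= M.
  move=> fl; have cf : cvgn f by apply/cvg_ex; exists l.
  have [M [_ MH]] := cvg_seq_bounded cf; exists (`|M| + 1) => n.
  by apply: MH => //; rewrite ltr_pwDr// ler_norm.
have [M1 H1] := bd _ _ ur; have [M2 H2] := bd _ _ ui.
by exists (M1 + M2) => n; apply: le_trans (cmod_le _) _; exact: lerD.
Qed.

Lemma is_derive_onem (y : R) : is_derive y 1 (fun y : R => 1 - y) (- 1).
Proof.
have := is_deriveB (is_derive_cst (1 : R) y 1) (is_derive_id y (1 : R)).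
by rewrite sub0r.
Qed.

(** Comparison with - M ln (1 - y), whose derivative is M / (1 - y): subtracting [e f] with [e] of
    modulus 1 leaves a function with nonnegative derivative, and e = 1, -1 give the two
    inequalities. *)
Lemma log_growth (f f1 : R -> R) (M : R) :
  (forall x : R, 0 <= x -> x < 1 -> is_derive x 1 f (f1 x)) ->
  (forall x, 0 <= x -> x < 1 -> `|f1 x| <= M / (1 - x)) ->
  forall x, 0 <= x -> x < 1 -> `|f x - f 0| <= - M * ln (1 - x).
Proof.
move=> df f1M x x0 x1.
have key (e : R) : `|e| = 1 -> e * (f x - f 0) <= - M * ln (1 - x).
  move=> e1; pose g y := - M * ln (1 - y) - e * f y.
  have dg (y : R) : 0 <= y -> y < 1 -> is_derive y 1 g (M / (1 - y) - e * f1 y).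
    move=> y0 y1; have d1 := df y y0 y1.
    have y1' : 0 < 1 - y by rewrite subr_gt0.
    have dl := is_derive1_ln y1'.
    have ds := is_derive_onem y.
    have dc := @is_derive1_comp _ (@ln R) (fun y : R => 1 - y) y _ _ dl ds.
    by rewrite /g; apply: is_derive_eq; rewrite /GRing.scale/=; ring.
  have dgo y : y \in `]0, x[%R -> is_derive y 1 g (M / (1 - y) - e * f1 y).
    by rewrite in_itv/= => /andP[/ltW y0 yx]; apply: dg => //; exact: lt_trans x1.
  have [|y] := MVT_segment x0 dgo.
    apply: derivable_within_continuous => y; rewrite in_itv/= => /andP[y0 yx].
    by have [] := dg y y0 (le_lt_trans yx x1).
  rewrite in_itv/= => /andP[y0 yx] gE.
  have yl1 := le_lt_trans yx x1.
  have : 0 <= g x - g 0.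
    rewrite gE mulr_ge0 ?subr0// subr_ge0.
    apply: le_trans (ler_norm _) _; rewrite normrM e1 mul1r; exact: f1M.
  by rewrite /g subr0 ln1 mulr0 sub0r; lra.
have k1 := key 1 (normr1 _).
have k2 : -1 * (f x - f 0) <= - M * ln (1 - x) by apply: key; rewrite normrN1.
by rewrite ler_norml; apply/andP; split; lra.
Qed.

Definition hcoef (a b c : C) (n : nat) : C := poch a n * poch b n / (poch c n * (n`!)%:R).

Section hypergeometric_function.
Context (a b : C).
Let c := a + b.
Hypothesis a0 : forall n : nat, a != - n%:R.
Hypothesis b0 : forall n : nat, b != - n%:R.
Hypothesis c0 : forall n : nat, c != - n%:R.

Let cf := hcoef a b c.
Let u := cdiffs cf.
Let L := cGamma c / (cGamma a * cGamma b).

Let fact_neq0 n : (n`!)%:R != 0 :> C.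
Proof. by rewrite pnatr_eq0 -lt0n fact_gt0. Qed.

Lemma hyp2F1E (x : R) : hyp2F1 a b c (x%:C)%C = cseries cf x.
Proof.
rewrite /hyp2F1 /climn /cseries; apply: complexP => /=; congr (limn _); apply/funext => N.
  by rewrite Re_sum /pseries /series/= big_mkord; apply: eq_bigr => i _; rewrite -ReX_real.
by rewrite Im_sum /pseries /series/= big_mkord; apply: eq_bigr => i _; rewrite -ImX_real.
Qed.

(** The identity is exact for every n because n^c = n^a n^b, so no asymptotic expansion of the
    coefficients is required. *)
Let uE n : u n = gauss_term c n * (gauss_term a n * gauss_term b n)^-1.
Proof.
rewrite /u /cdiffs /cf /hcoef /gauss_term factS natrM /c cpowRD -/c.
have := cpowR_neq0 n%:R a; have := cpowR_neq0 n%:R b.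
have := poch_neq0 n.+1 a0; have := poch_neq0 n.+1 b0; have := poch_neq0 n.+1 c0.
have N0 : n.+1%:R != 0 :> C by rewrite pnatr_eq0.
move: (fact_neq0 n) N0; move: (n.+1%:R) (n`!%:R) => N f.
move: (cpowR _ a) (cpowR _ b) (poch a _) (poch b _) (poch c _) => x y p q r.
by move=> *; field; do ?[apply/andP; split].
Qed.

Lemma ccvg_hyp_deriv_coef : ccvg u L.
Proof.
have [ca ga] := cGammaP a0; have [cb gb] := cGammaP b0; have [cc gc] := cGammaP c0.
rewrite (_ : u = fun n => gauss_term c n * (gauss_term a n * gauss_term b n)^-1); last first.
  by apply/funext => n; exact: uE.
apply: ccvgM => //; apply: ccvgV; first by rewrite mulf_neq0.
exact: ccvgM.
Qed.

Let uM : exists M, forall n, cmod (u n) <= M.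
Proof. exact: ccvg_bounded ccvg_hyp_deriv_coef. Qed.

Lemma subexp_hcoef : subexp cf.
Proof.
have [M HM] := uM; apply: (@subexp_bounded _ _ (1 + M)) => -[|n].
  have -> : cf 0%N = 1 by rewrite /cf /hcoef /poch !big_ord0 fact0 mulr1 divr1.
  have -> : cmod (1 : C) = 1 by apply: (@complexI R); rewrite -cmodE normr1.
  by rewrite lerDl; apply: le_trans (HM 0%N); exact: cmod_ge0.
have -> : cf n.+1 = (n.+1%:R)^-1 * u n.
  by rewrite /u /cdiffs mulKf// pnatr_eq0.
rewrite cmodM; apply: le_trans (_ : _ <= cmod (u n)) _; last first.
  by apply: le_trans (HM n) _; rewrite lerDr.
rewrite ler_piMl ?cmod_ge0//.
have -> : cmod (n.+1%:R^-1 : C) = n.+1%:R^-1.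
  by apply: (@complexI R); rewrite -cmodE normfV normr_nat fmorphV rmorph_nat.
by rewrite invf_le1// ler1n.
Qed.

Let hrec n : (c + n%:R) * u n = (a + n%:R) * (b + n%:R) * cf n.
Proof.
rewrite /u /cdiffs /cf /hcoef factS natrM !pochS.
have := poch_neq0 n c0.
have cn : c + n%:R != 0 by rewrite addr_eq0.
have N0 : n.+1%:R != 0 :> C by rewrite pnatr_eq0.
move: (fact_neq0 n) N0 cn; move: (n.+1%:R) (n`!%:R) (n%:R) => N f m.
move: (poch a _) (poch b _) (poch c n) => p q r.
by move=> *; field; do ?[apply/andP; split].
Qed.

(** Truncated sums satisfy the hypergeometric equation up to finitely many terms of the form n^j
    times a coefficient times X^N, all vanishing in the limit when |X| < 1; no infinite series has
    to be reindexed. *)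
Let ode_partial (X : C) N :
  X * (1 - X) * (\sum_(0 <= n < N) cdiffs u n * X ^+ n)
  + (c - (c + 1) * X) * (\sum_(0 <= n < N) u n * X ^+ n)
  - a * b * (\sum_(0 <= n < N) cf n * X ^+ n) =
  (1 - X) * (N%:R * u N * X ^+ N) - (N%:R * (N%:R * cf N) * X ^+ N) - c * (N%:R * cf N * X ^+ N).
Proof.
elim: N => [|N IH]; first by rewrite !big_geq//; ring.
rewrite !big_nat_recr//=.
have uN : N.+1%:R * cf N.+1 = u N by [].
have vN : cdiffs u N = N.+1%:R * u N.+1 by [].
rewrite uN vN exprS; have := hrec N; rewrite /c; move: IH.
rewrite /c -natr1; move: (X ^+ N) => Y.
move: (\sum_(0 <= n < N) _) (\sum_(0 <= n < N) _) (\sum_(0 <= n < N) _) => S2 S1 S0.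
move: (N%:R) (u N) (u N.+1) (cf N) => n v w z IH hr.
(* The induction step is the sum of the induction hypothesis and X^N times the coefficient
   recurrence. *)
have E := congr1 (fun t => Y * t) hr; rewrite /= in E.
move/eqP: IH; rewrite -subr_eq0 => /eqP IH.
move/eqP: E; rewrite -subr_eq0 => /eqP E.
apply/eqP; rewrite -subr_eq0 -[X in _ == X](addr0 0) -{1}IH -E.
by apply/eqP; ring.
Qed.

Lemma hypergeometric_ode (x : R) : `|x| < 1 -> let X := (x%:C)%C in
  X * (1 - X) * cseries (cdiffs u) x + (c - (c + 1) * X) * cseries u x
  - a * b * cseries cf x = 0.
Proof.
move=> x1 X; have s0 := subexp_hcoef; have s1 := subexp_cdiffs s0; have s2 := subexp_cdiffs s1.
pose E N := X * (1 - X) * (\sum_(0 <= n < N) cdiffs u n * X ^+ n)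
  + (c - (c + 1) * X) * (\sum_(0 <= n < N) u n * X ^+ n)
  + - (a * b) * (\sum_(0 <= n < N) cf n * X ^+ n).
have lim1 : ccvg E (X * (1 - X) * cseries (cdiffs u) x + (c - (c + 1) * X) * cseries u x
  + - (a * b) * cseries cf x).
  by do 2?apply: ccvgD; apply: ccvgM; (exact: ccvg_cst || exact: ccvg_cseries).
have lim2 : ccvg E 0.
  have -> : 0 = (1 - X) * 0 + - 1 * 0 + - c * 0 :> C by ring.
  have -> : E = fun N => (1 - X) * (N%:R * u N * X ^+ N) + - 1 * (N%:R * (N%:R * cf N) * X ^+ N)
     + - c * (N%:R * cf N * X ^+ N).
    by apply/funext => N; rewrite /E !mulNr mul1r ode_partial.
  do 2?apply: ccvgD; apply: ccvgM; (exact: ccvg_cst || apply: ccvg_subexp0 => //).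
  - exact: subexp_muln.
  - exact: subexp_muln (subexp_muln _).
  - exact: subexp_muln.
by have := ccvg_unique lim1 lim2; rewrite mulNr.
Qed.

Lemma cvg_hyp_deriv :
  t * Re (cseries u (1 - t)) @[t --> 0^'+] --> Re L /\
  t * Im (cseries u (1 - t)) @[t --> 0^'+] --> Im L.
Proof. by have [ur ui] := ccvg_hyp_deriv_coef; split; exact: cvg_abel. Qed.

Lemma hyp_bounds : exists2 K, 0 <= K & forall t : R, 0 < t -> t <= 1 ->
  cmod (cseries cf (1 - t)) <= K * (1 - ln t) /\ t * cmod (cseries u (1 - t)) <= K.
Proof.
have [M HM] := uM; have M0 : 0 <= M by apply: le_trans (HM 0%N); exact: cmod_ge0.
exists (cmod (cseries cf 0) * 2 + 2 * M) => [|t t0 t1].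
  by rewrite addr_ge0// mulr_ge0// cmod_ge0.
set x := 1 - t; have x0 : 0 <= x by rewrite subr_ge0.
have x1 : x < 1 by rewrite gtrBl.
have tx : 1 - x = t by rewrite /x opprB addrC subrK.
have uR (y : R) : 0 <= y -> y < 1 -> `|Re (cseries u y)| <= M / (1 - y).
  by move=> y0 y1; apply: pseries_le => // n; apply: le_trans (HM n); exact: Re_le_cmod.
have uI (y : R) : 0 <= y -> y < 1 -> `|Im (cseries u y)| <= M / (1 - y).
  by move=> y0 y1; apply: pseries_le => // n; apply: le_trans (HM n); exact: Im_le_cmod.
have cd (y : R) : 0 <= y -> y < 1 -> cder (cseries cf) y (cseries u y).
  by move=> y0 y1; apply: cder_cseries; [exact: subexp_hcoef|rewrite ger0_norm].
have ln0 := ln_le0 t1.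
have c00 := cmod_ge0 (cseries cf 0).
split.
  have lr := @log_growth (fun y => Re (cseries cf y)) (fun y => Re (cseries u y)) M
    (fun y y0 y1 => (cd y y0 y1).1) uR x x0 x1.
  have li := @log_growth (fun y => Im (cseries cf y)) (fun y => Im (cseries u y)) M
    (fun y y0 y1 => (cd y y0 y1).2) uI x x0 x1.
  rewrite tx in lr li.
  rewrite -[cseries cf x](subrK (cseries cf 0)); apply: le_trans (cmodD _ _) _.
  have h1 : cmod (cseries cf x - cseries cf 0) <= 2 * M * - ln t.
    apply: le_trans (cmod_le _) _; rewrite ReD ReN ImD ImN.
    rewrite (_ : 2 * M * - ln t = - M * ln t + - M * ln t); last by ring.
    exact: lerD.
  apply: le_trans (lerD h1 (lexx _)) _.
  move: (cmod _) (ln t) ln0 c00 => w l l0 w0.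
  have m1 : 0 <= M * - l by rewrite mulr_ge0// oppr_ge0.
  have m2 : 0 <= w * - l by rewrite mulr_ge0// oppr_ge0.
  nra.
have h2 : cmod (cseries u x) <= 2 * M / t.
  apply: le_trans (cmod_le _) _; have := lerD (uR x x0 x1) (uI x x0 x1).
  by rewrite tx -mulrDl -mulr2n mulr_natl.
apply: le_trans (ler_wpM2l (ltW t0) h2) _.
by rewrite mulrCA divff ?gt_eqF// mulr1 lerDr mulr_ge0.
Qed.

End hypergeometric_function.
End hypergeometric.

(** * The radial solution: equation, growth and behaviour at the origin *)

Section radial_solution.
Context {R : realType}.
Local Notation C := (R[i]%C).
Local Notation Re := complex.Re.
Local Notation Im := complex.Im.

Definition rcvg (f : R -> C) (z : C) :=
  (Re (f t) @[t --> 0^'+] --> Re z) /\ (Im (f t) @[t --> 0^'+] --> Im z).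

Lemma rcvgD f g (z w : C) : rcvg f z -> rcvg g w -> rcvg (fun t => f t + g t) (z + w).
Proof.
move=> [fr fi] [gr gi]; split.
  by under eq_fun do rewrite ReD; rewrite ReD; exact: cvgD.
by under eq_fun do rewrite ImD; rewrite ImD; exact: cvgD.
Qed.

Lemma rcvgM f g (z w : C) : rcvg f z -> rcvg g w -> rcvg (fun t => f t * g t) (z * w).
Proof.
move=> [fr fi] [gr gi]; split.
  under eq_fun do rewrite ReM; rewrite ReM.
  by apply: cvgB; exact: cvgM.
under eq_fun do rewrite ImM; rewrite ImM.
by apply: cvgD; exact: cvgM.
Qed.

Lemma rcvg_cst (z : C) : rcvg (fun=> z) z.
Proof. by split; exact: cvg_cst. Qed.

Lemma rcvg_cder f (z : C) : cder f 0 z -> rcvg f (f 0).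
Proof.
by move=> [[dr _] [di _]]; split; apply: cvg_at_right_filter;
  apply/differentiable_continuous/derivable1_diffP.
Qed.

Lemma rcvg0_le (f : R -> C) (K : R) :
  (forall t, 0 < t -> t < 1 -> cmod (f t) <= K * (t * (1 - 2 * ln t))) -> rcvg f 0.
Proof.
move=> fK.
have K0 : 0 <= K.
  have h0 : 0 < 2^-1 :> R by lra.
  have h1 : 2^-1 < 1 :> R by lra.
  have l0 := ln_le0 (ltW h1).
  have := le_trans (cmod_ge0 _) (fK _ h0 h1); rewrite pmulr_lge0// mulr_gt0//.
  by move: l0; lra.
have lim0 : K * (e + 4 * Num.sqrt e) @[e --> 0^'+] --> (0 : R).
  rewrite [X in _ --> X](_ : _ = K * (0 + 4 * Num.sqrt 0)); last by rewrite sqrtr0; ring.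
  apply: cvgM; first exact: cvg_cst.
  apply: cvgD; first exact: cvg_at_right_filter.
  apply: cvgM; first exact: cvg_cst.
  by apply: cvg_at_right_filter; exact: sqrt_continuous.
have bnd (p : C -> R) : (forall z, `|p z| <= cmod z) -> p (f t) @[t --> 0^'+] --> (0 : R).
  move=> pm; apply/cvgrPdist_le => eps eps0; near=> e.
  have e0 : 0 < e by near: e; exact: nbhs_right_gt.
  have e1 : e < 1 by near: e; apply: nbhs_right_lt.
  rewrite sub0r normrN; apply: le_trans (pm _) _; apply: le_trans (fK _ e0 e1) _.
  apply: le_trans (ler_wpM2l K0 (xlnx_le e0)) _.
  rewrite (le_trans (ler_norm _))// -normrN -sub0r.
  by near: e; move/cvgrPdist_le : lim0; apply.
by split; apply: bnd => z; [exact: Re_le_cmod|exact: Im_le_cmod].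
Unshelve. all: by end_near. Qed.

Lemma cmod_real (x : R) : 0 <= x -> cmod (x%:C)%C = x.
Proof. by move=> x0; rewrite /cmod/= expr0n/= addr0 sqrtr_sqr ger0_norm. Qed.

Lemma is_derive_inv (x : R) : x != 0 -> is_derive x 1 (fun x : R => x^-1) (- x^-1 ^+ 2).
Proof.
move=> x0; have := @is_deriveV R (fun x => x) x 1 1 x0 (is_derive_id x 1).
by move/is_derive_eq; apply; rewrite /GRing.scale/= mulr1 exprVn.
Qed.

Context (s A : C) (k : R).
Let a := s - (`|k|%:C)%C.
Let b := s + (`|k|%:C)%C.
Hypothesis a0 : forall n : nat, a != - n%:R.
Hypothesis b0 : forall n : nat, b != - n%:R.
Hypothesis c0 : forall n : nat, 2 * s != - n%:R.

Let ab : a + b = 2 * s.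
Proof. by rewrite /a /b; ring. Qed.
Let c0' : forall n : nat, a + b != - n%:R.
Proof. by rewrite ab. Qed.

Let F0 := cseries (hcoef a b (a + b)).
Let F1 := cseries (cdiffs (hcoef a b (a + b))).
Let F2 := cseries (cdiffs (cdiffs (hcoef a b (a + b)))).
Let V (x : R) : C := (x^-1%:C)%C.

Let cder0 (x : R) : `|x| < 1 -> cder F0 x (F1 x).
Proof. by move=> x1; apply: cder_cseries => //; exact: subexp_hcoef. Qed.
Let cder1 (x : R) : `|x| < 1 -> cder F1 x (F2 x).
Proof. by move=> x1; apply: cder_cseries => //; apply: subexp_cdiffs; exact: subexp_hcoef. Qed.
Let cder2 (x : R) : `|x| < 1 -> exists z, cder F2 x z.
Proof.
move=> x1; eexists; apply: cder_cseries => //.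
by do 2!apply: subexp_cdiffs; exact: subexp_hcoef.
Qed.
Let cderV (x : R) : 0 < x -> cder V x (- V x ^+ 2).
Proof.
move=> x0; have := cder_real (is_derive_inv (lt0r_neq0 x0)).
by move/cder_eq; apply; rewrite rmorphN rmorphXn.
Qed.

(** In the variable x = 1/y, with [V x = 1/x]. The power x^s stays factored out of both derivatives,
    so that it divides out of the differential equation. *)
Let g x := cpowR x s * F0 x.
Let g1 x := cpowR x s * (F1 x + s * V x * F0 x).
Let g2 x := cpowR x s * (F2 x + 2 * s * V x * F1 x + s * (s - 1) * V x ^+ 2 * F0 x).

Let cder_g (x : R) : 0 < x -> x < 1 -> cder g x (g1 x).
Proof.
move=> x0 x1; have xa : `|x| < 1 by rewrite gtr0_norm.
have := cderM (cder_cpowR s x0) (cder0 xa).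
by move/cder_eq; apply; rewrite /g1 -/(V x); ring.
Qed.

Let cder_g1 (x : R) : 0 < x -> x < 1 -> cder g1 x (g2 x).
Proof.
move=> x0 x1; have xa : `|x| < 1 by rewrite gtr0_norm.
have := cderM (cder_cpowR s x0) (cderD (cder1 xa)
  (cderM (cderM (cder_cst s x) (cderV x0)) (cder0 xa))).
by move/cder_eq; apply; rewrite /g2 -/(V x); ring.
Qed.

Let cder_g2 (x : R) : 0 < x -> x < 1 -> exists z, cder g2 x z.
Proof.
move=> x0 x1; have xa : `|x| < 1 by rewrite gtr0_norm.
have [z dz] := cder2 xa.
eexists; apply: cderM; first exact: cder_cpowR.
apply: cderD; last first.
  apply: cderM; last exact: cder0.
  by apply: cderM; [exact: cder_cst|apply: cderM; exact: cderV].
apply: cderD; first exact: dz.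
by apply: cderM; [apply: cderM; [exact: cder_cst|exact: cderV]|exact: cder1].
Qed.

(* Here [t = |w|^2], so that [y^-1 = 1 - t]. *)
Definition sol (t : R) : C := A * g (1 - t).
Definition sol1 (t : R) : C := - A * g1 (1 - t).
Definition sol2 (t : R) : C := A * g2 (1 - t).

Let cder_onem (f : R -> C) (t : R) (z : C) : cder f (1 - t) z ->
  cder (fun t => f (1 - t)) t (- z).
Proof.
move=> fz; have /cder_eq := cder_comp (r := fun t : R => 1 - t) fz (is_derive_onem t).
by apply; rewrite rmorphN rmorph1 mulrN1.
Qed.

Let onem (t : R) : 0 < t -> t < 1 -> 0 < 1 - t /\ 1 - t < 1.
Proof. by move=> t0 t1; rewrite subr_gt0 gtrBl. Qed.

Lemma cder_sol (t : R) : 0 < t -> t < 1 -> cder sol t (sol1 t).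
Proof.
move=> t0 t1; have [x0 x1] := onem t0 t1.
have := cderM (cder_cst A t) (cder_onem (cder_g x0 x1)).
by move/cder_eq; apply; rewrite /sol1; ring.
Qed.

Lemma cder_sol1 (t : R) : 0 < t -> t < 1 -> cder sol1 t (sol2 t).
Proof.
move=> t0 t1; have [x0 x1] := onem t0 t1.
have := cderM (cder_cst (- A) t) (cder_onem (cder_g1 x0 x1)).
by move/cder_eq; apply; rewrite /sol2; ring.
Qed.

Lemma cder_sol2 (t : R) : 0 < t -> t < 1 -> exists z, cder sol2 t z.
Proof.
move=> t0 t1; have [x0 x1] := onem t0 t1; have [z dz] := cder_g2 x0 x1.
by eexists; exact: (cderM (cder_cst A t) (cder_onem dz)).
Qed.

Lemma cder_inv_onem (t : R) : 0 < t -> t < 1 ->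
  cder (fun t => ((1 - t)^-1%:C)%C) t (((1 - t)^-1%:C)%C ^+ 2).
Proof.
move=> t0 t1; have [x0 x1] := onem t0 t1.
by have /cder_eq := cder_onem (cderV x0); apply; rewrite opprK.
Qed.

(** The value that the radial equation (1 - t)^2 (h' + t h'') + (k^2 (1 - t) + s (1 - s)) h = 0
    assigns to h' + t h'', a quarter of the Laplacian of h(|w|^2). *)
Definition sol_op (t : R) : C :=
  - ((k ^+ 2 * (1 - t))%:C%C + s * (1 - s)) * ((1 - t)^-1%:C)%C ^+ 2 * sol t.

Lemma sol_ode (t : R) : 0 < t -> t < 1 -> sol1 t + (t%:C)%C * sol2 t = sol_op t.
Proof.
move=> t0 t1; have [x0 x1] := onem t0 t1.
rewrite /sol_op /sol1 /sol2 /sol /g1 /g2 /g; set x := 1 - t in x0 x1 *.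
have xa : `|x| < 1 by rewrite gtr0_norm.
have := hypergeometric_ode a0 b0 c0' xa; rewrite /= -/F2 -/F1 -/F0.
have XV : (x%:C)%C * V x = 1 by rewrite /V -rmorphM/= divff ?gt_eqF.
have -> : (t%:C)%C = 1 - (x%:C)%C by rewrite /x rmorphB/= rmorph1; ring.
(* This is a b = s^2 - k^2. *)
have -> : ((k ^+ 2 * x)%:C)%C = s ^+ 2 * (x%:C)%C - a * b * (x%:C)%C.
  rewrite -(real_normK (num_real k)) rmorphM rmorphXn /a /b /=; ring.
rewrite ab; move: XV; rewrite -/(V x); move: (x%:C)%C (V x) (cpowR x s) => X W P XW.
move: (F0 x) (F1 x) (F2 x) (a * b) => f f1 f2 q E.
have X0 : X != 0 by apply: contra_eq_neq XW => ->; rewrite mul0r eq_sym oner_neq0.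
have -> : W = X^-1 by apply: (mulfI X0); rewrite XW mulfV.
apply/eqP; rewrite -subr_eq0; apply/eqP.
(* The difference of the two sides is A x^(s - 1) times the left-hand side of the hypergeometric
   equation. *)
transitivity (A * P * X^-1 * (X * (1 - X) * f2 + (2 * s - (2 * s + 1) * X) * f1 - q * f)).
  by field.
by rewrite E mulr0.
Qed.

Lemma sol_bounds (rho : R) : 0 <= rho -> rho < 1 -> exists2 M, 0 <= M &
  forall t : R, 0 < t -> t <= rho ->
  [/\ cmod (sol t) <= M * (1 - ln t), cmod (sol_op t) <= M * (1 - ln t),
     cmod (((1 - t)^-1%:C)%C * sol t) <= M * (1 - ln t) & t * cmod (sol1 t) <= M].
Proof.
move=> r0 r1; have [K K0 HK] := hyp_bounds a0 b0 c0'.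
(* For t <= rho one has 1 - rho <= x < 1, so [E] bounds the modulus of x^s and [D] bounds 1/x. *)
pose E := expR (`|Re s| * - ln (1 - rho)); pose D := (1 - rho)^-1.
have E0 : 0 <= E by exact: expR_ge0.
have r1' : 0 < 1 - rho by rewrite subr_gt0.
have D0 : 0 <= D by rewrite invr_ge0 ltW.
have A0 := cmod_ge0 A; have s0 := cmod_ge0 s; have ss0 := cmod_ge0 (s * (1 - s)).
pose M1 := cmod A * (E * K).
have M10 : 0 <= M1 by rewrite !mulr_ge0.
pose M2 := (k ^+ 2 + cmod (s * (1 - s))) * D ^+ 2 * M1.
have M20 : 0 <= M2 by rewrite mulr_ge0// mulr_ge0 ?sqr_ge0// addr_ge0// sqr_ge0.
pose M3 := D * M1; have M30 : 0 <= M3 by rewrite mulr_ge0.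
pose M4 := cmod A * (E * (K + cmod s * D * K)).
have M40 : 0 <= M4 by rewrite !mulr_ge0// addr_ge0// !mulr_ge0.
exists (M1 + M2 + M3 + M4) => [|t t0 tr]; first by rewrite !addr_ge0.
have t1 : t < 1 by exact: le_lt_trans r1.
have [x0 x1] := onem t0 t1.
have [HF Hu] := HK t t0 (ltW t1).
have PE : cmod (cpowR (1 - t) s) <= E.
  rewrite cmod_cpowR ler_expR; apply: le_trans (ler_norm _) _; rewrite normrM.
  apply: ler_wpM2l => //; rewrite ler0_norm ?ln_le0 ?(ltW x1)// lerN2 ler_ln ?posrE//.
  by rewrite lerD2l lerN2.
have VD : cmod (((1 - t)^-1%:C)%C) <= D.
  by rewrite cmod_real ?invr_ge0 ?(ltW x0)// lef_pV2 ?posrE// lerD2l lerN2.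
have l0 : 0 <= 1 - ln t by rewrite subr_ge0 (le_trans (ln_le0 (ltW t1))).
have solM : cmod (sol t) <= M1 * (1 - ln t).
  rewrite /sol /g cmodM cmodM /M1 -!mulrA; apply: ler_wpM2l => //.
  by apply: ler_pM => //; exact: cmod_ge0.
have le_all (m : R) : m <= M1 + M2 + M3 + M4 -> m * (1 - ln t) <= (M1 + M2 + M3 + M4) * (1 - ln t).
  by move=> ?; exact: ler_wpM2r.
(* Needed for [sol1]: it makes t F bounded, while t F' is bounded directly. *)
have tl : t * (1 - ln t) <= 1.
  have lt : ln t^-1 <= t^-1 - 1.
    have -> : t^-1 = 1 + (t^-1 - 1) by rewrite addrCA subrr addr0.
    have := @le_ln1Dx R (t^-1 - 1); rewrite (addrC 1) addrK; apply.
    by rewrite ltrBDr addrC subrr invr_gt0.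
  rewrite lnV ?posrE// in lt; rewrite -[leRHS](mulfV (lt0r_neq0 t0)); apply: ler_wpM2l; first exact: ltW.
  by move: (t^-1) (ln t) lt => y l; lra.
split.
- apply: le_trans solM _; apply: le_all.
  by rewrite -!addrA lerDl !addr_ge0.
- apply: (@le_trans _ _ (M2 * (1 - ln t))); last first.
    by apply: le_all; rewrite (addrC M1) -!addrA lerDl !addr_ge0.
  rewrite /sol_op cmodM [X in X * _]cmodM cmodN /M2 -[leRHS]mulrA; apply: ler_pM => //.
  + by rewrite mulr_ge0 ?cmod_ge0.
  + exact: cmod_ge0.
  + apply: ler_pM; rewrite ?cmod_ge0//.
      apply: le_trans (cmodD _ _) _; rewrite lerD2r cmod_real; last by rewrite mulr_ge0 ?sqr_ge0 ?ltW.
      by rewrite ler_piMr ?sqr_ge0 ?ltW.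
    by rewrite expr2 cmodM expr2; apply: ler_pM; rewrite ?cmod_ge0.
- apply: (@le_trans _ _ (M3 * (1 - ln t))); last first.
    by apply: le_all; rewrite -(addrA (M1 + M2)) addrCA lerDl !addr_ge0.
  by rewrite cmodM /M3 -mulrA; apply: ler_pM; rewrite ?cmod_ge0.
- apply: (@le_trans _ _ M4); last by rewrite lerDr !addr_ge0.
  rewrite /sol1 /g1 cmodM cmodM cmodN mulrCA; apply: ler_wpM2l => //.
  rewrite mulrCA; apply: ler_pM; rewrite ?cmod_ge0//.
    by rewrite mulr_ge0 ?cmod_ge0// ltW.
  apply: le_trans (ler_wpM2l (ltW t0) (cmodD _ _)) _; rewrite mulrDr; apply: lerD => //.
  rewrite cmodM cmodM mulrCA -!mulrA; apply: ler_wpM2l => //.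
  apply: ler_pM; rewrite ?cmod_ge0 ?mulr_ge0 ?cmod_ge0 ?(ltW t0)//.
  apply: le_trans (ler_wpM2l (ltW t0) HF) _.
  by rewrite mulrCA ler_piMr.
Qed.

(** Only F' contributes: t F is O(t (1 - ln t)) and disappears, and x^s and 1/x tend to 1. *)
Lemma rcvg_sol1 : rcvg (fun t => (t%:C)%C * sol1 t)
  (- A * (cGamma (2 * s) / (cGamma a * cGamma b))).
Proof.
have [K K0 HK] := hyp_bounds a0 b0 c0'.
set L := _ / _.
have -> : - A * L = - A * 1 * (L + s * 1 * 0) by ring.
have r1 : rcvg (fun t => cpowR (1 - t) s) 1.
  have := rcvg_cder (cder_onem (f := fun x => cpowR x s) (t := 0) (z := _) _).
  rewrite subr0 cpow1R => H; apply: (H (s * cpowR 1 s * (1^-1%:C)%C)).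
  exact: cder_cpowR.
have r2 : rcvg (fun t => V (1 - t)) 1.
  have d1 : cder (fun t => V (1 - t)) 0 (- - V (1 - 0) ^+ 2).
    by apply: cder_onem; apply: cderV; rewrite subr0.
  by have := rcvg_cder d1; rewrite subr0 /V invr1.
have r3 : rcvg (fun t => (t%:C)%C * F1 (1 - t)) L.
  have [lr li] := cvg_hyp_deriv a0 b0 c0'; have LE : L = cGamma (a + b) / (cGamma a * cGamma b) by rewrite ab.
  rewrite LE.
  split.
    by under eq_fun do rewrite ReM/= mul0r subr0; exact: lr.
  by under eq_fun do rewrite ImM/= mul0r addr0; exact: li.
have r4 : rcvg (fun t => (t%:C)%C * F0 (1 - t)) 0.
  apply: (@rcvg0_le _ K) => t t0 t1; rewrite cmodM cmod_real ?(ltW t0)//.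
  have [HF _] := HK t t0 (ltW t1).
  apply: le_trans (ler_wpM2l (ltW t0) HF) _; rewrite mulrCA; apply: ler_wpM2l => //.
  apply: ler_wpM2l; first exact: ltW.
  by have := ln_le0 (ltW t1); lra.
have := rcvgM (rcvgM (rcvg_cst (- A)) r1) (rcvgD r3 (rcvgM (rcvgM (rcvg_cst s) r2) r4)).
rewrite (_ : (fun t => - A * _ * _) = (fun t => (t%:C)%C * sol1 t))//.
by apply/funext => t; rewrite /sol1 /g1; ring.
Qed.

Lemma solE (p : R * R) : disc p -> A * cpowR (1 - sqn p)^-1 (- s) *
  hyp2F1 a b (2 * s) ((1 - sqn p)^-1^-1%:C)%C = sol (sqn p).
Proof.
rewrite /disc /= => p1.
by rewrite invrK cpowRV ?subr_gt0// opprK -ab hyp2F1E /sol /g mulrA.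
Qed.

End radial_solution.

(** * From the complex operator to real radial operators *)

Section weak_solution.
Context {R : realType}.
Local Notation C := (R[i]%C).
Local Notation Re := (@complex.Re R).
Local Notation Im := (@complex.Im R).

(* In polar coordinates: [- h \Delta phi + 4 l phi + q d(phi)/d(theta)], with coefficients
   depending on [t = |w|^2]; the Laplacian of [h (|w|^2)] is [4 (h1 + t h2)]. *)
Definition radial_op (h l q : R -> R) (phi : R -> R -> R) (p : R * R) : R :=
  - h (sqn p) * (pdw [:: true; true] phi p.1 p.2 + pdw [:: false; false] phi p.1 p.2)
  + 4 * l (sqn p) * phi p.1 p.2
  + q (sqn p) * (p.1 * pdw [:: false] phi p.1 p.2 - p.2 * pdw [:: true] phi p.1 p.2).

(** Replacing h1 + t h2 by the function [l] that the radial equation provides makes the integrand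
    free of derivatives of [h], hence of the same form as the original one at every point of the
    disc, the origin included. *)
Lemma green_radial_op (rho : R) (phi : R -> R -> R) (h h1 h2 l q q1 : R -> R) (M c : R) :
  0 <= M -> rho < 1 -> smooth2 phi ->
  (forall u v, rho < u ^+ 2 + v ^+ 2 -> phi u v = 0) ->
  (forall t : R, 0 < t -> t < 1 -> is_derive t 1 h (h1 t)) ->
  (forall t : R, 0 < t -> t < 1 -> is_derive t 1 h1 (h2 t)) ->
  (forall t : R, 0 < t -> t < 1 -> is_derive t 1 q (q1 t)) ->
  (forall t : R, 0 < t -> t < 1 -> {for t, continuous h2}) ->
  (forall t : R, 0 < t -> t < 1 -> {for t, continuous q1}) ->
  (forall t : R, 0 < t -> t < 1 -> h1 t + t * h2 t = l t) ->
  (forall t : R, 0 < t -> t <= rho -> `|h t| <= M * (1 - ln t)) ->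
  (forall t : R, 0 < t -> t <= rho -> `|q t| <= M * (1 - ln t)) ->
  (forall t : R, 0 < t -> t <= rho -> `|l t| <= M * (1 - ln t)) ->
  (forall t : R, 0 < t -> t <= rho -> `|t * h1 t| <= M) ->
  t * h1 t @[t --> 0^'+] --> c ->
  (leb2 R).-integrable (@disc R) (fun p => (radial_op h l q phi p)%:E) /\
  \int[leb2 R]_(p in @disc R) radial_op h l q phi p = - (4 * pi * c * phi 0 0).
Proof.
move=> M0 r1 sphi phi0 dh dh1 dq ch2 cq1 hl hM qM lM kM limk.
(* The identity holds on all of the disc only if [h1 0] is redefined as [l 0]. *)
pose k1 (t : R) := if t == 0 then l 0 else h1 t.
have k1E t : 0 < t -> k1 t = h1 t by move=> t0; rewrite /k1 gt_eqF.
have dk (t : R) : 0 < t -> t < 1 -> is_derive t 1 h (k1 t).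
  by move=> t0 t1; rewrite k1E//; exact: dh.
have dk1 (t : R) : 0 < t -> t < 1 -> is_derive t 1 k1 (h2 t).
  move=> t0 t1; apply: near_eq_is_derive (dh1 t t0 t1).
  by near=> y; rewrite k1E//; near: y; exact: lt_nbhsr.
have lM' t : 0 < t -> t <= rho -> `|k1 t + t * h2 t| <= M * (1 - ln t).
  by move=> t0 tr; rewrite k1E// hl ?(le_lt_trans tr)//; exact: lM.
have kM' t : 0 < t -> t <= rho -> `|t * k1 t| <= M.
  by move=> t0 tr; rewrite k1E//; exact: kM.
have limk' : t * k1 t @[t --> 0^'+] --> c.
  apply: cvg_trans limk; apply: near_eq_cvg; near=> t; rewrite k1E//.
have [ig ie] := green_identity M0 r1 sphi phi0 dk dk1 dq ch2 cq1 hM qM lM' kM' limk'.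
have eqd : {in @disc R, (fun p : R * R => (fun u v : R => let t := u ^+ 2 + v ^+ 2 in
     - h t * (pdw [:: true; true] phi u v + pdw [:: false; false] phi u v) +
     4 * (k1 t + t * h2 t) * phi u v +
     q t * (u * pdw [:: false] phi u v - v * pdw [:: true] phi u v)) p.1 p.2)
   =1 radial_op h l q phi}.
  move=> p; rewrite inE /disc/= => p1; rewrite /radial_op -/(sqn p).
  have -> // : k1 (sqn p) + sqn p * h2 (sqn p) = l (sqn p).
  have [->|p0] := eqVneq (sqn p) 0; first by rewrite /k1 eqxx mul0r addr0.
  have pp : 0 < sqn p by rewrite lt_neqAle eq_sym p0 addr_ge0 ?sqr_ge0.
  by rewrite k1E// hl.
have mD := @measurable_disc R.
split.
  refine (@eq_integrable _ _ _ (leb2 R) _ mD _ _ _ ig).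
  by move=> p pD; congr EFin; exact: eqd.
by rewrite -ie; apply: eq_Rintegral => p pD; rewrite -(eqd p pD).
Unshelve. all: by end_near. Qed.

Context (s A : C) (k : R).
Hypothesis a0 : forall n : nat, s - (`|k|%:C)%C != - n%:R.
Hypothesis b0 : forall n : nat, s + (`|k|%:C)%C != - n%:R.
Hypothesis c0 : forall n : nat, 2 * s != - n%:R.

Let V (t : R) : C := ((1 - t)^-1%:C)%C.

(** Coefficient of d/d(theta) for kappa = -4 i k: the first-order part of - D_(-k) is - i k (1 - t)
    d/d(theta), because w d/dw - wbar d/dwbar = - i d/d(theta), and the density 4/(1 - t)^2 leaves
    one factor 1/(1 - t). *)
Definition sol_rot (kappa : C) (t : R) : C := kappa * (V t * sol s A k t).

(** [P] is real-linear and t is real, so it commutes with the radial equation. It is applied to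
    whole coefficients, after the complex constants [A] and [kappa] have been multiplied in. *)
Lemma green_sol (P : C -> R) (kappa : C) (rho : R) (phi : R -> R -> R) :
  P = Re \/ P = Im -> 0 <= rho -> rho < 1 -> smooth2 phi ->
  (forall u v, rho < u ^+ 2 + v ^+ 2 -> phi u v = 0) ->
  let f := radial_op (P \o sol s A k) (P \o sol_op s A k) (P \o sol_rot kappa) phi in
  (leb2 R).-integrable (@disc R) (fun p => (f p)%:E) /\
  \int[leb2 R]_(p in @disc R) f p =
    - (4 * pi * P (- A * (cGamma (2 * s) /
         (cGamma (s - (`|k|%:C)%C) * cGamma (s + (`|k|%:C)%C)))) * phi 0 0).
Proof.
move=> PE r0 r1 sphi phi0 f.
have Pder (g : R -> C) t z : cder g t z -> is_derive t 1 (P \o g) (P z).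
  by case: PE => ->; case.
have Pcont (g : R -> C) t : (exists z, cder g t z) -> {for t, continuous (P \o g)}.
  by move=> [z /Pder[dg _]]; apply/differentiable_continuous/derivable1_diffP.
have Pcmod z : `|P z| <= cmod z.
  by case: PE => ->; [exact: Re_le_cmod|exact: Im_le_cmod].
have PD z w : P (z + w) = P z + P w by case: PE => ->; case: z w => ? ? [].
have PM (x : R) z : P ((x%:C)%C * z) = x * P z.
  by case: PE => ->; case: z => ? ? /=; rewrite mul0r ?subr0 ?addr0.
have Plim (g : R -> C) z : rcvg g z -> P (g t) @[t --> 0^'+] --> P z.
  by case: PE => ->; case.
have [M M0 HM] := sol_bounds A a0 b0 c0 r0 r1.
have dV t : 0 < t -> t < 1 -> cder V t (V t ^+ 2) by exact: cder_inv_onem.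
have dQ t : 0 < t -> t < 1 -> cder (sol_rot kappa) t
    (kappa * (V t ^+ 2 * sol s A k t + V t * sol1 s A k t)).
  move=> t0 t1.
  have := cderM (cder_cst kappa t) (cderM (dV t t0 t1) (cder_sol A a0 b0 c0 t0 t1)).
  by move/cder_eq; apply; rewrite mul0r add0r.
have Kk : M <= (1 + cmod kappa) * M by rewrite ler_peMl// lerDl cmod_ge0.
have l0 t : 0 < t -> t <= rho -> 0 <= 1 - ln t.
  by move=> t0 tr; rewrite subr_ge0 (le_trans (ln_le0 _))// (le_trans tr)// ltW.
apply: (@green_radial_op rho phi _ (P \o sol1 s A k) (P \o sol2 s A k) _ _
  (fun t => P (kappa * (V t ^+ 2 * sol s A k t + V t * sol1 s A k t)))
  ((1 + cmod kappa) * M)) => //.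
- by apply: mulr_ge0 => //; rewrite addr_ge0// cmod_ge0.
- by move=> t t0 t1; apply: Pder; exact: cder_sol.
- by move=> t t0 t1; apply: Pder; exact: cder_sol1.
- by move=> t t0 t1; apply: Pder; exact: dQ.
- by move=> t t0 t1; apply: Pcont; exact: cder_sol2.
- move=> t t0 t1; apply: Pcont; eexists.
  apply: cderM; first exact: cder_cst.
  apply: cderD; apply: cderM.
  + by apply: cderM; exact: dV.
  + exact: (cder_sol A a0 b0 c0 t0 t1).
  + exact: dV.
  + exact: (cder_sol1 A a0 b0 c0 t0 t1).
- by move=> t t0 t1 /=; rewrite -(sol_ode A a0 b0 c0 t0 t1) PD PM.
- move=> t t0 tr; apply: le_trans (Pcmod _) _; have [H _ _ _] := HM t t0 tr.
  by apply: le_trans H _; apply: ler_wpM2r => //; exact: l0.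
- move=> t t0 tr; apply: le_trans (Pcmod _) _; have [_ _ H _] := HM t t0 tr.
  rewrite /sol_rot cmodM -mulrA; apply: ler_pM; rewrite ?cmod_ge0//.
  by rewrite lerDr.
- move=> t t0 tr; apply: le_trans (Pcmod _) _; have [_ H _ _] := HM t t0 tr.
  by apply: le_trans H _; apply: ler_wpM2r => //; exact: l0.
- move=> t t0 tr; rewrite -PM; apply: le_trans (Pcmod _) _; have [_ _ _ H] := HM t t0 tr.
  by rewrite cmodM cmod_real; [exact: le_trans H Kk|exact: ltW].
- under eq_fun do rewrite /= -PM.
  exact: Plim (rcvg_sol1 A a0 b0 c0).
Qed.

(** The parameter [lam] enters only through s (1 - s), and the density cancels the weight (1 - t)^2
    of the second-order part, leaving a flat Laplacian. *)
Lemma integrand_sol (lam : C) (hs : s * (1 - s) = 1 / 4 + lam ^+ 2)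
    (phi : R -> R -> C) (p : R * R) : disc p ->
  sol s A k (sqn p) * (- Dop (- k) phi p.1 p.2 - lam ^+ 2 * phi p.1 p.2) * ((hdens p)%:C)%C =
  - sol s A k (sqn p) * (cpd [:: true; true] phi p.1 p.2 + cpd [:: false; false] phi p.1 p.2)
  + 4 * sol_op s A k (sqn p) * phi p.1 p.2
  + sol_rot (- (4 * (k%:C)%C * 'i)) (sqn p)
    * ((p.1%:C)%C * cpd [:: false] phi p.1 p.2 - (p.2%:C)%C * cpd [:: true] phi p.1 p.2).
Proof.
rewrite /disc /= => p1; rewrite /sol_op /sol_rot hs /V /Dop /hdens -/(sqn p).
have x0 : 1 - sqn p != 0 by rewrite subr_eq0 gt_eqF.
rewrite /dwdwbar /dw /dwbar.
have iE (u v : R) : (u +i* v = (u%:C) + 'i * (v%:C))%C by rewrite [LHS]complexE.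
rewrite iE [(p.1 -i* p.2)%C]iE.
move: (sol _ _ _ _) (cpd _ _ _ _) (cpd _ _ _ _) (cpd _ _ _ _) (cpd _ _ _ _) (phi _ _) => S A1 A2 A3 A4 f.
have {1 2 3 4}-> : sqn p = 1 - (1 - sqn p) by rewrite opprB addrC subrK.
move: (1 - sqn p) x0 => x x0.
rewrite !(rmorph_nat, rmorphD, rmorphN, rmorphM, rmorphXn, fmorphV, rmorph1)/=.
have X0 : (x%:C)%C != 0 by rewrite fmorph_eq0.
(* The imaginary unit can become a free variable: its squares cancel in w d/dw - wbar d/dwbar. *)
move: (x%:C)%C X0 (k%:C)%C (p.1%:C)%C (p.2%:C)%C ('i : C) => X X0 K U W I.
by field.
Qed.

(** Separates a product of complex coefficients and complex [phi] into four real operators, each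
    within reach of Green's identity. *)
Lemma Re_Im_op (h l q : R -> C) (phi : R -> R -> C) (p : R * R) :
  let f (P Q : C -> R) := radial_op (P \o h) (P \o l) (P \o q) (fun u v => Q (phi u v)) p in
  - h (sqn p) * (cpd [:: true; true] phi p.1 p.2 + cpd [:: false; false] phi p.1 p.2)
  + 4 * l (sqn p) * phi p.1 p.2
  + q (sqn p) * ((p.1%:C)%C * cpd [:: false] phi p.1 p.2 - (p.2%:C)%C * cpd [:: true] phi p.1 p.2)
  = ((f Re Re - f Im Im) +i* (f Re Im + f Im Re))%C.
Proof.
move=> f; have -> : (4 : C) = (4%:C)%C by rewrite rmorph_nat.
rewrite /f /radial_op /cpd /comp.
move: (pdw _ _ _ _) (pdw _ _ _ _) (pdw _ _ _ _) (pdw _ _ _ _).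
move: (pdw _ _ _ _) (pdw _ _ _ _) (pdw _ _ _ _) (pdw _ _ _ _).
case: (h _) (l _) (q _) (phi _ _) => [hr hi] [lr li] [qr qi] [fr fi] /= *.
by apply/complexP; rewrite /=; ring.
Qed.

(** [rho] is the square of the support radius, radial quantities being measured in t = |w|^2. *)
Lemma smooth_supp (phi : R -> R -> C) : test_fun phi -> exists2 rho, 0 <= rho < 1 &
  forall u v, rho < u ^+ 2 + v ^+ 2 -> Re (phi u v) = 0 /\ Im (phi u v) = 0.
Proof.
move=> [_ [_ [r [/andP[r0 r1] rphi]]]]; exists (r ^+ 2).
  by rewrite sqr_ge0 expr_lt1.
by move=> u v /rphi ->.
Qed.

End weak_solution.

(** * Assembly of the four real identities *)

Local Open Scope complex_scope.
Unset Implicit Arguments.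

Theorem theorem1 (R : realType) (k : R) (lam s : R[i])
  (hs : s * (1 - s) = 1 / 4 + lam ^+ 2)
  (h1 : forall n : nat, s - `|k|%:C != - n%:R)
  (h2 : forall n : nat, s + `|k|%:C != - n%:R)
  (h3 : forall n : nat, 2 * s != - n%:R)
  (phi : R -> R -> R[i]) (hphi : test_fun phi) :
  let integrand (p : R * R) : R[i] :=
    Gk k s p * (- Dop (- k) phi p.1 p.2 - lam ^+ 2 * phi p.1 p.2)
    * (hdens p)%:C in
  (leb2 R).-integrable (@disc R) (fun p => (complex.Re (integrand p))%:E) /\
  (leb2 R).-integrable (@disc R) (fun p => (complex.Im (integrand p))%:E) /\
  (\int[leb2 R]_(p in @disc R) complex.Re (integrand p))
  +i* (\int[leb2 R]_(p in @disc R) complex.Im (integrand p))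
  = phi 0 0.
Proof.
move=> integrand.
set A := cGamma (s - `|k|%:C) * cGamma (s + `|k|%:C) / ((4 * pi)%:C * cGamma (2 * s)).
pose kappa := - (4 * k%:C * 'i).
pose f P Q := radial_op (P \o sol s A k) (P \o sol_op s A k) (P \o sol_rot s A k kappa)
  (fun u v => Q (phi u v) : R).
have fE p : p \in @disc R -> integrand p =
    (f (@complex.Re R) (@complex.Re R) p - f (@complex.Im R) (@complex.Im R) p)
    +i* (f (@complex.Re R) (@complex.Im R) p + f (@complex.Im R) (@complex.Re R) p).
  rewrite inE => pD.
  have := integrand_sol A k hs phi pD.
  rewrite (Re_Im_op (sol s A k) (sol_op s A k) (sol_rot s A k kappa) phi p) => <-.
  by rewrite /integrand /Gk -/A solE.
have [_ g1] := cGammaP h1; have [_ g2] := cGammaP h2; have [_ g3] := cGammaP h3.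
have p4 : 4 * pi != 0 :> R by rewrite mulf_neq0 ?pnatr_eq0// gt_eqF// pi_gt0.
(* The constant is real, so its imaginary part is 0: the two identities with imaginary coefficients
   integrate to 0, and those with real coefficients give the real and imaginary parts of
   [phi 0 0]. *)
have AE : - A * (cGamma (2 * s) / (cGamma (s - `|k|%:C) * cGamma (s + `|k|%:C)))
    = (- (4 * pi)^-1)%:C.
  have p0 : (4 * pi)%:C != 0 :> R[i] by rewrite fmorph_eq0.
  rewrite rmorphN fmorphV /A /=; move: ((4 * pi)%:C) p0 => X X0.
  move: (cGamma (s - `|k|%:C)) (cGamma (s + `|k|%:C)) (cGamma (2 * s)) g1 g2 g3 => x y z x0 y0 z0.
  by field; rewrite X0 x0 y0 z0.
have [s1 [s2 _]] := hphi; have [rho /andP[r0 r1] supp] := smooth_supp hphi.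
have [] := green_sol A h1 h2 h3 kappa (or_introl erefl) r0 r1 s1 (fun u v uv => (supp u v uv).1).
rewrite AE -/(f _ _) => iRR eRR.
have [] := green_sol A h1 h2 h3 kappa (or_introl erefl) r0 r1 s2 (fun u v uv => (supp u v uv).2).
rewrite AE -/(f _ _) => iRI eRI.
have [] := green_sol A h1 h2 h3 kappa (or_intror erefl) r0 r1 s1 (fun u v uv => (supp u v uv).1).
rewrite AE -/(f _ _) => iIR eIR.
have [] := green_sol A h1 h2 h3 kappa (or_intror erefl) r0 r1 s2 (fun u v uv => (supp u v uv).2).
rewrite AE -/(f _ _) => iII eII.
have mD := @measurable_disc R.
split.
  refine (@eq_integrable _ _ _ (leb2 R) _ mD _ _ _ (@integrableB _ _ _ (leb2 R) _ mD _ _ iRR iII)).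
  by move=> p pD; rewrite fE.
split.
  refine (@eq_integrable _ _ _ (leb2 R) _ mD _ _ _ (@integrableD _ _ _ (leb2 R) _ mD _ _ iRI iIR)).
  by move=> p pD; rewrite fE.
have -> : \int[leb2 R]_(p in @disc R) complex.Re (integrand p) = complex.Re (phi 0 0).
  transitivity (\int[leb2 R]_(p in @disc R)
    (f (@complex.Re R) (@complex.Re R) p - f (@complex.Im R) (@complex.Im R) p)).
    by apply: eq_Rintegral => p pD; rewrite fE.
  rewrite (@RintegralB _ _ _ (leb2 R) _ _ _ mD iRR iII) eRR eII /=.
  by rewrite mulr0 mul0r oppr0 subr0 mulrN mulfV// mulN1r opprK.
have -> : \int[leb2 R]_(p in @disc R) complex.Im (integrand p) = complex.Im (phi 0 0).
  transitivity (\int[leb2 R]_(p in @disc R)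
    (f (@complex.Re R) (@complex.Im R) p + f (@complex.Im R) (@complex.Re R) p)).
    by apply: eq_Rintegral => p pD; rewrite fE.
  rewrite (@RintegralD _ _ _ (leb2 R) _ _ _ mD iRI iIR) eRI eIR /=.
  by rewrite mulr0 mul0r oppr0 addr0 mulrN mulfV// mulN1r opprK.
by case: (phi 0 0).
Qed.
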